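(* Let $\mathcal{G}$ be an ultragraph, $R$ a unital commutative ring, and $L_R(\mathcal{G})$ the ultragraph Leavitt path algebra associated to $\mathcal{G}$. Then: (i) The centraliser of the diagonal algebra $D(L_R(\mathcal{G}))$ in $L_R(\mathcal{G})$ is the core algebra $M(L_R(\mathcal{G}))$. (ii) The core algebra $M(L_R(\mathcal{G}))$ is a maximal commutative subalgebra of $L_R(\mathcal{G})$. (iii) If the center $Z(L_R(\mathcal{G}))$ equals $M(L_R(\mathcal{G}))$ and $\mathcal{G}$ is connected, then $L_R(\mathcal{G})$ is (isomorphic to) either $R$ or $R[x,x^{-1}]$, i.e. the ultragraph $\mathcal{G}$ is either a single vertex (with no edges) or consists of one vertex and one edge.
   Context: Rings with identity are assumed nonzero. An ultragraph is a quadruple $\mathcal{G}=(G^0,\mathcal{G}^1,r,s)$ with $G^0,\mathcal{G}^1$ countable sets, $G^0\neq\emptyset$, $s:\mathcal{G}^1\to G^0$, $r:\mathcal{G}^1\to P(G^0)\setminus\{\emptyset\}$ ($P$ = power set). $\mathcal{G}^0\subseteq P(G^0)$ is the smallest family containing $\emptyset$, all $\{v\}$, all $r(e)$, and closed under finite unions and finite intersections. A sink is a vertex $v$ with $s^{-1}(v)=\emptyset$. $L_R(\mathcal{G})$ is the universal (not necessarily unital) $R$-algebra with generators $\{s_e,s_e^*:e\in\mathcal{G}^1\}\cup\{p_A:A\in\mathcal{G}^0\}$ and relations: (1) $p_\emptyset=0$, $p_Ap_B=p_{A\cap B}$, $p_{A\cup B}=p_A+p_B-p_{A\cap B}$ for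 $A,B\in\mathcal{G}^0$; (2) $p_{s(e)}s_e=s_ep_{r(e)}=s_e$, $p_{r(e)}s_e^*=s_e^*p_{s(e)}=s_e^*$; (3) $s_e^*s_f=\delta_{e,f}p_{r(e)}$ for $e,f\in\mathcal{G}^1$; (4) $p_v=\sum_{s(e)=v}s_es_e^*$ whenever $0<|s^{-1}(v)|<\infty$ ($p_v=p_{\{v\}}$). Paths. $\mathcal{L}^*$ consists of the empty word $\omega$ and all words $e_1\cdots e_n$ ($n\ge1$) of edges with $s(e_{i+1})\in r(e_i)$. For $\alpha=e_1\cdots e_n$, $s(\alpha)=s(e_1)$, $r(\alpha)=r(e_n)$; $r(\omega)=G^0$. A loop is a path $\alpha$ with $|\alpha|\ge1$ and $s(\alpha)\in r(\alpha)$. An exit for a loop $\alpha=\alpha_1\cdots\alpha_n$ is either an edge $e$ such that for some $i$, $s(e)\in r(\alpha_i)$ but $e\ne\alpha_{i+1}$ (with $\alpha_{n+1}=\alpha_1$), or a sink $w$ with $w\in r(\alpha_i)$ for some $i$. $\mathcal{G}$ is connected if for all $v,w\in G^0$ there is a finite path $\gamma$ with $s(\gamma)=v$ and $w\in r(\gamma)$ (for $v=w$ the length-zero path $\{v\}$ is allowed). Subalgebras. For $\alpha=\alpha_1\cdots\alpha_n$ put $s_\alpha=s_{\alpha_1}\cdots s_{\alpha_n}$, $s_{\alpha^*}=s_{\alpha_n}^*\cdots s_{\alpha_1}^*$; factors indexed by $\omega$ are omitted. $G_{\mathcal{G}}=\{s_\alpha p_As_{\beta^*}:\alpha,\beta\in\mathcal{L}^*,\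 A\in\mathcal{G}^0,\ r(\alpha)\cap A\cap r(\beta)\neq\emptyset\}$. The diagonal algebra $D(L_R(\mathcal{G}))$ is the $R$-subalgebra generated by the elements of $G_{\mathcal{G}}$ with $\alpha=\beta$. The (abelian) core $M(L_R(\mathcal{G}))$ is the $R$-subalgebra generated by the elements of $G_{\mathcal{G}}$ such that: $\alpha=\beta$; or $\alpha=\beta\lambda$ with $\lambda$ a loop without exits; or $\beta=\alpha\lambda$ with $\lambda$ a loop without exits. *)

(* Defs.v *)
From HB Require Import structures.
From mathcomp Require Import all_boot all_order all_algebra generic_quotient.
From mathcomp Require Import finmap boolp classical_sets.
From mathcomp.multinomials Require Import monalg.

Set Implicit Arguments.
Unset Strict Implicit.
Unset Printing Implicit Defensive.

Import GRing.Theory.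
Local Open Scope classical_set_scope.
Local Open Scope ring_scope.

HB.mixin Record Lmodule_isNonUnitalAlgebra (R : comNzRingType) A
    of GRing.Lmodule R A := {
  nmul : A -> A -> A;
  nmulA : associative nmul;
  nmulDl : left_distributive nmul +%R;
  nmulDr : right_distributive nmul +%R;
  nscaleAl : forall (a : R) (x y : A), a *: nmul x y = nmul (a *: x) y;
  nscaleAr : forall (a : R) (x y : A), a *: nmul x y = nmul x (a *: y)
}.

#[short(type="nuAlgType")]
HB.structure Definition NonUnitalAlgebra (R : comNzRingType) :=
  {A of GRing.Lmodule R A & Lmodule_isNonUnitalAlgebra R A}.

Notation "x ** y" := (nmul x y)
  (at level 40, left associativity) : ring_scope.

Section Subalgebras.
Variables (R : comNzRingType) (A : nuAlgType R).

Definition subalgebra (B : set A) : Prop :=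
  [/\ B 0,
      forall x y, B x -> B y -> B (x + y),
      forall (a : R) x, B x -> B (a *: x) &
      forall x y, B x -> B y -> B (x ** y)].

Definition gen_subalgebra (X : set A) : set A := smallest subalgebra X.

Definition centraliser (B : set A) : set A :=
  [set x | forall y, B y -> x ** y = y ** x].

Definition nu_center : set A := centraliser setT.

Definition commutative_set (B : set A) : Prop :=
  forall x y, B x -> B y -> x ** y = y ** x.

Definition maximal_commutative_subalgebra (B : set A) : Prop :=
  [/\ subalgebra B, commutative_set B &
      forall C : set A,
        subalgebra C -> commutative_set C -> B `<=` C -> C = B].

Definition isomorphic_algebra (B : algType R) : Prop :=
  exists f : {linear A -> B},
    bijective f /\ (forall x y, f (x ** y) = f x * f y).

End Subalgebras.

Arguments nu_center {R} A.
Arguments isomorphic_algebra {R} A B.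

Section Homomorphisms.
Variables (R : comNzRingType) (A B : nuAlgType R).

Definition nu_hom (f : A -> B) : Prop :=
  [/\ forall x y, f (x + y) = f x + f y,
      forall (a : R) x, f (a *: x) = a *: f x &
      forall x y, f (x ** y) = f x ** f y].

End Homomorphisms.

Inductive term (R X : Type) : Type :=
| TGen of X
| TZero
| TAdd of term R X & term R X
| TScale of R & term R X
| TMul of term R X & term R X.

Arguments TGen {R X} _.
Arguments TZero {R X}.
Arguments TAdd {R X} _ _.
Arguments TScale {R X} _ _.
Arguments TMul {R X} _ _.

HB.instance Definition _ (R X : Type) := gen_eqMixin (term R X).
HB.instance Definition _ (R X : Type) := gen_choiceMixin (term R X).

Section Presentation.
Variables (R : comNzRingType) (X : Type).
Variable rels : term R X -> term R X -> Prop.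

(* the least congruence containing [rels] whose quotient is an algebra *)
Inductive cong : term R X -> term R X -> Prop :=
| cong_rel t u : rels t u -> cong t u
| cong_refl t : cong t t
| cong_sym t u : cong t u -> cong u t
| cong_trans t u v : cong t u -> cong u v -> cong t v
| cong_add t t' u u' : cong t t' -> cong u u' -> cong (TAdd t u) (TAdd t' u')
| cong_scale a t t' : cong t t' -> cong (TScale a t) (TScale a t')
| cong_mul t t' u u' : cong t t' -> cong u u' -> cong (TMul t u) (TMul t' u')
| cong_addA t u v : cong (TAdd t (TAdd u v)) (TAdd (TAdd t u) v)
| cong_addC t u : cong (TAdd t u) (TAdd u t)
| cong_add0 t : cong (TAdd TZero t) t
| cong_addN t : cong (TAdd (TScale (- 1) t) t) TZero
| cong_scaleA a b t : cong (TScale a (TScale b t)) (TScale (a * b) t)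
| cong_scale1 t : cong (TScale 1 t) t
| cong_scaleDr a t u :
    cong (TScale a (TAdd t u)) (TAdd (TScale a t) (TScale a u))
| cong_scaleDl a b t : cong (TScale (a + b) t) (TAdd (TScale a t) (TScale b t))
| cong_mulA t u v : cong (TMul t (TMul u v)) (TMul (TMul t u) v)
| cong_mulDl t u v : cong (TMul (TAdd t u) v) (TAdd (TMul t v) (TMul u v))
| cong_mulDr t u v : cong (TMul t (TAdd u v)) (TAdd (TMul t u) (TMul t v))
| cong_scaleAl a t u : cong (TScale a (TMul t u)) (TMul (TScale a t) u)
| cong_scaleAr a t u : cong (TScale a (TMul t u)) (TMul t (TScale a u)).

Definition congb (t u : term R X) : bool := `[< cong t u >].

Lemma congb_equiv : equiv_class_of congb.
Proof.
split=> [t|t u|u t v].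
- exact/asboolP/cong_refl.
- by apply/asboolP/asboolP; apply: cong_sym.
- by move=> /asboolP tu /asboolP uv; apply/asboolP/(cong_trans tu).
Qed.

Canonical cong_equiv := EquivRelPack congb_equiv.

Definition presented : Type := {eq_quot cong_equiv}%qT.

HB.instance Definition _ := Choice.on presented.

Definition tclass (t : term R X) : presented := \pi_({eq_quot cong_equiv})%qT t.

Lemma tclassE t u : tclass t = tclass u <-> cong t u.
Proof.
split=> [/eqP|tu]; first by rewrite eqmodE => /asboolP.
by apply/eqP; rewrite eqmodE; exact/asboolP.
Qed.

Definition lift_term (x : presented) : term R X :=
  @repr _ {eq_quot cong_equiv}%qT x.

Lemma lift_termK : cancel lift_term tclass.
Proof. by move=> x; exact: reprK. Qed.

Lemma tclass_ind (P : presented -> Prop) :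
  (forall t, P (tclass t)) -> forall x, P x.
Proof. by move=> Pt x; rewrite -[x]lift_termK. Qed.

Lemma cong_lift t : cong (lift_term (tclass t)) t.
Proof. by apply/tclassE; rewrite lift_termK. Qed.

Definition padd (x y : presented) := tclass (TAdd (lift_term x) (lift_term y)).
Definition popp (x : presented) := tclass (TScale (- 1) (lift_term x)).
Definition pscale (a : R) (x : presented) := tclass (TScale a (lift_term x)).
Definition pmul (x y : presented) := tclass (TMul (lift_term x) (lift_term y)).

Lemma paddE t u : padd (tclass t) (tclass u) = tclass (TAdd t u).
Proof. by apply/tclassE/cong_add; exact: cong_lift. Qed.

Lemma poppE t : popp (tclass t) = tclass (TScale (- 1) t).
Proof. by apply/tclassE/cong_scale; exact: cong_lift. Qed.

Lemma pscaleE a t : pscale a (tclass t) = tclass (TScale a t).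
Proof. by apply/tclassE/cong_scale; exact: cong_lift. Qed.

Lemma pmulE t u : pmul (tclass t) (tclass u) = tclass (TMul t u).
Proof. by apply/tclassE/cong_mul; exact: cong_lift. Qed.

Let pE := (paddE, poppE, pscaleE, pmulE).

Lemma paddA : associative padd.
Proof.
elim/tclass_ind=> t; elim/tclass_ind=> u; elim/tclass_ind=> v.
by rewrite !pE; apply/tclassE/cong_addA.
Qed.

Lemma paddC : commutative padd.
Proof.
elim/tclass_ind=> t; elim/tclass_ind=> u.
by rewrite !pE; apply/tclassE/cong_addC.
Qed.

Lemma padd0 : left_id (tclass TZero) padd.
Proof. by elim/tclass_ind=> t; rewrite !pE; apply/tclassE/cong_add0. Qed.

Lemma paddN : left_inverse (tclass TZero) popp padd.
Proof. by elim/tclass_ind=> t; rewrite !pE; apply/tclassE/cong_addN. Qed.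

HB.instance Definition _ := GRing.isZmodule.Build presented
  paddA paddC padd0 paddN.

Lemma pscaleA a b x : pscale a (pscale b x) = pscale (a * b) x.
Proof. by elim/tclass_ind: x => t; rewrite !pE; apply/tclassE/cong_scaleA. Qed.

Lemma pscale1 : left_id 1 pscale.
Proof. by elim/tclass_ind=> t; rewrite !pE; apply/tclassE/cong_scale1. Qed.

Lemma pscaleDr : right_distributive pscale +%R.
Proof.
move=> a; elim/tclass_ind=> t; elim/tclass_ind=> u.
by rewrite /+%R /= !pE; apply/tclassE/cong_scaleDr.
Qed.

Lemma pscaleDl x : {morph pscale^~ x : a b / a + b}.
Proof.
move=> a b; elim/tclass_ind: x => t.
by rewrite !pE /+%R /= !pE; apply/tclassE/cong_scaleDl.
Qed.

HB.instance Definition _ := GRing.Zmodule_isLmodule.Build R presented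
  pscaleA pscale1 pscaleDr pscaleDl.

Lemma tclass0 : tclass TZero = 0. Proof. by []. Qed.

Lemma tclassD t u : tclass (TAdd t u) = tclass t + tclass u.
Proof. by rewrite -paddE. Qed.

Lemma tclassZ a t : tclass (TScale a t) = a *: tclass t.
Proof. by rewrite -pscaleE. Qed.

Lemma pmulA : associative pmul.
Proof.
elim/tclass_ind=> t; elim/tclass_ind=> u; elim/tclass_ind=> v.
by rewrite !pE; apply/tclassE/cong_mulA.
Qed.

Lemma pmulDl : left_distributive pmul +%R.
Proof.
elim/tclass_ind=> t; elim/tclass_ind=> u; elim/tclass_ind=> v.
by rewrite -(tclassD t u) !pmulE -tclassD; apply/tclassE/cong_mulDl.
Qed.

Lemma pmulDr : right_distributive pmul +%R.
Proof.
elim/tclass_ind=> t; elim/tclass_ind=> u; elim/tclass_ind=> v.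
by rewrite -(tclassD u v) !pmulE -tclassD; apply/tclassE/cong_mulDr.
Qed.

Lemma pscaleAl a x y : a *: pmul x y = pmul (a *: x) y.
Proof.
elim/tclass_ind: x => t; elim/tclass_ind: y => u.
by rewrite -(tclassZ a t) !pmulE -tclassZ; apply/tclassE/cong_scaleAl.
Qed.

Lemma pscaleAr a x y : a *: pmul x y = pmul x (a *: y).
Proof.
elim/tclass_ind: x => t; elim/tclass_ind: y => u.
by rewrite -(tclassZ a u) !pmulE -tclassZ; apply/tclassE/cong_scaleAr.
Qed.

HB.instance Definition _ := Lmodule_isNonUnitalAlgebra.Build R presented
  pmulA pmulDl pmulDr pscaleAl pscaleAr.

Lemma tclassM t u : tclass (TMul t u) = tclass t ** tclass u.
Proof. by rewrite -pmulE. Qed.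

Fixpoint term_eval (B : nuAlgType R) (g : X -> B) (t : term R X) : B :=
  match t with
  | TGen x => g x
  | TZero => 0
  | TAdd t u => term_eval g t + term_eval g u
  | TScale a t => a *: term_eval g t
  | TMul t u => term_eval g t ** term_eval g u
  end.

Lemma term_eval_cong (B : nuAlgType R) (g : X -> B) :
  (forall t u, rels t u -> term_eval g t = term_eval g u) ->
  forall t u, cong t u -> term_eval g t = term_eval g u.
Proof.
move=> grel t u; elim=> //=.
- by move=> {}t {}u v _ -> _ ->.
- by move=> {}t t' {}u u' _ -> _ ->.
- by move=> a {}t t' _ ->.
- by move=> {}t t' {}u u' _ -> _ ->.
- by move=> *; rewrite addrA.
- by move=> *; rewrite addrC.
- by move=> *; rewrite add0r.
- by move=> *; rewrite scaleN1r addNr.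
- by move=> *; rewrite scalerA.
- by move=> *; rewrite scale1r.
- by move=> *; rewrite scalerDr.
- by move=> *; rewrite scalerDl.
- by move=> *; rewrite nmulA.
- by move=> *; rewrite nmulDl.
- by move=> *; rewrite nmulDr.
- by move=> *; rewrite nscaleAl.
- by move=> *; rewrite nscaleAr.
Qed.

Lemma presented_universal (B : nuAlgType R) (g : X -> B) :
  (forall t u, rels t u -> term_eval g t = term_eval g u) ->
  exists! f : presented -> B, nu_hom f /\ forall x, f (tclass (TGen x)) = g x.
Proof.
move=> grel; have ge := term_eval_cong grel.
pose f x := term_eval g (lift_term x).
have fE t : f (tclass t) = term_eval g t by apply/ge/cong_lift.
exists f; split.
  split=> [|x]; last by rewrite fE.
  split.
  - elim/tclass_ind=> t; elim/tclass_ind=> u.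
    by rewrite -tclassD !fE.
  - by move=> a; elim/tclass_ind=> t; rewrite -tclassZ !fE.
  - elim/tclass_ind=> t; elim/tclass_ind=> u.
    by rewrite -tclassM !fE.
move=> h [[hD hZ hM] hg]; apply/funext; elim/tclass_ind=> t; rewrite fE.
elim: t => /= [x||t IHt u IHu|a t IHt|t IHt u IHu].
- by rewrite hg.
- by rewrite tclass0 -[in RHS](scale0r 0) hZ scale0r.
- by rewrite tclassD hD IHt IHu.
- by rewrite tclassZ hZ IHt.
- by rewrite tclassM hM IHt IHu.
Qed.

End Presentation.

(* [countType] covers both finite and countably infinite sets *)
Record ultragraph := Ultragraph {
  vertex : countType;
  edge : countType;
  src : edge -> vertex;
  rng : edge -> set vertex;
  vertex_inhabited : inhabited vertex;
  rng_neq0 : forall e, rng e !=set0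
}.

Arguments src {_} _.
Arguments rng {_} _.

Section Ultragraph.
Variable G : ultragraph.
Implicit Types (e f : edge G) (v w : vertex G) (al la : seq (edge G)).

Definition gen_vertex_family (F : set (set (vertex G))) : Prop :=
  [/\ F set0, forall v, F [set v], forall e, F (rng e),
      setU_closed F & setI_closed F].

(* the family $\mathcal{G}^0$ *)
Definition gen_vertex : set (set (vertex G)) :=
  smallest gen_vertex_family set0.

Lemma gen_vertexP : gen_vertex_family gen_vertex.
Proof.
split=> [F [] []//|v F [] []//|e F [] []//|A B gA gB F|A B gA gB F] F0.
- by case: (F0) => -[_ _ _ FU _ _]; apply: FU; [exact: gA|exact: gB].
- by case: (F0) => -[_ _ _ _ FI _]; apply: FI; [exact: gA|exact: gB].
Qed.

Definition gset : Type := {A : set (vertex G) | gen_vertex A}.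

Lemma gen_vertex0 : gen_vertex set0.
Proof. by case: gen_vertexP. Qed.

Lemma gen_vertex1 v : gen_vertex [set v].
Proof. by case: gen_vertexP. Qed.

Lemma gen_vertex_rng e : gen_vertex (rng e).
Proof. by case: gen_vertexP. Qed.

Lemma gen_vertexU : setU_closed gen_vertex.
Proof. by case: gen_vertexP. Qed.

Lemma gen_vertexI : setI_closed gen_vertex.
Proof. by case: gen_vertexP. Qed.

Definition gset0 : gset := exist _ set0 gen_vertex0.
Definition gset1 v : gset := exist _ [set v] (gen_vertex1 v).
Definition gset_rng e : gset := exist _ (rng e) (gen_vertex_rng e).
Definition gsetU (A B : gset) : gset :=
  exist _ (sval A `|` sval B) (gen_vertexU (proj2_sig A) (proj2_sig B)).
Definition gsetI (A B : gset) : gset :=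
  exist _ (sval A `&` sval B) (gen_vertexI (proj2_sig A) (proj2_sig B)).

Definition sink v : Prop := forall e, src e <> v.

(* $\mathcal{L}^*$: the empty word is [[::]] *)
Definition upath al : bool := sorted (fun e f => src f \in rng e) al.

Definition urange al : set (vertex G) :=
  if al is e :: al' then rng (last e al') else setT.

Definition loop al : Prop :=
  if al is e :: _ then upath al /\ urange al (src e) else False.

(* The default value of [nth] is irrelevant.  Positions are used instead of
   [path.next] because an edge may occur several times in a loop. *)
Definition has_exit al : Prop :=
  (exists (i : nat) e,
     [/\ (i < size al)%N, rng (nth e al i) (src e) &
         e <> nth e al (i.+1 %% size al)]) \/
  (exists a w, [/\ a \in al, sink w & rng a w]).

Definition loop_without_exits al : Prop := loop al /\ ~ has_exit al.

Definition ultragraph_connected : Prop :=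
  forall v w, v = w \/
    exists e al, [/\ upath (e :: al), src e = v & urange (e :: al) w].

Definition single_vertex : Prop := exists v, forall w, w = v.

Definition no_edges : Prop := forall e, False.

Definition single_edge : Prop := exists e, forall f, f = e.

End Ultragraph.

Inductive leavitt_gen (G : ultragraph) : Type :=
| GenP of gset G
| GenS of edge G
| GenSs of edge G.

Section Leavitt.
Variables (R : comNzRingType) (G : ultragraph).

Notation tm := (term R (leavitt_gen G)).
Notation tP A := (TGen (GenP A) : tm).
Notation tS e := (TGen (GenS e) : tm).
Notation tSs e := (TGen (GenSs e) : tm).

Inductive leavitt_rel : tm -> tm -> Prop :=
| rel_P0 : leavitt_rel (tP (gset0 G)) TZero
| rel_PI A B : leavitt_rel (TMul (tP A) (tP B)) (tP (gsetI A B))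
| rel_PU A B : leavitt_rel (tP (gsetU A B))
    (TAdd (TAdd (tP A) (tP B)) (TScale (- 1) (tP (gsetI A B))))
| rel_srcS e : leavitt_rel (TMul (tP (gset1 (src e))) (tS e)) (tS e)
| rel_Srng e : leavitt_rel (TMul (tS e) (tP (gset_rng e))) (tS e)
| rel_rngSs e : leavitt_rel (TMul (tP (gset_rng e)) (tSs e)) (tSs e)
| rel_Sssrc e : leavitt_rel (TMul (tSs e) (tP (gset1 (src e)))) (tSs e)
| rel_SsS e : leavitt_rel (TMul (tSs e) (tS e)) (tP (gset_rng e))
| rel_SsS0 e f : e <> f -> leavitt_rel (TMul (tSs e) (tS f)) TZero
| rel_CK v (es : seq (edge G)) :
    (* [es] enumerates $s^{-1}(v)$, nonempty and finite *)
    es <> [::] -> uniq es -> (forall e, e \in es <-> src e = v) ->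
    leavitt_rel (tP (gset1 v))
      (foldr TAdd TZero [seq TMul (tS e) (tSs e) | e <- es]).

Definition leavitt : nuAlgType R := presented leavitt_rel.

Definition lP (A : gset G) : leavitt := tclass leavitt_rel (tP A).
Definition lS (e : edge G) : leavitt := tclass leavitt_rel (tS e).
Definition lSs (e : edge G) : leavitt := tclass leavitt_rel (tSs e).

(* $s_\alpha p_A s_{\beta^*}$ *)
Definition monomial (al : seq (edge G)) (A : gset G) (be : seq (edge G)) :
    leavitt :=
  foldr (fun e x => lS e ** x) (foldr (fun e x => x ** lSs e) (lP A) be) al.

Definition admissible (al : seq (edge G)) (A : gset G) (be : seq (edge G)) :=
  [/\ upath al, upath be & urange al `&` sval A `&` urange be !=set0].

Definition diagonal_algebra : set leavitt :=
  gen_subalgebra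
    [set x | exists al A, admissible al A al /\ x = monomial al A al].

Definition core_algebra : set leavitt :=
  gen_subalgebra
    [set x | exists al A be,
       [/\ admissible al A be,
           [\/ al = be,
               exists2 la, loop_without_exits la & al = be ++ la |
               exists2 la, loop_without_exits la & be = al ++ la] &
           x = monomial al A be]].

End Leavitt.

Arguments diagonal_algebra R G : clear implicits.
Arguments core_algebra R G : clear implicits.

Section LeavittUniversal.
Variables (R : comNzRingType) (G : ultragraph).

Definition leavitt_family (B : nuAlgType R)
    (p : gset G -> B) (s ss : edge G -> B) : Prop :=
  [/\ [/\ p (gset0 G) = 0,
          forall A A', p A ** p A' = p (gsetI A A') &
          forall A A', p (gsetU A A') = p A + p A' - p (gsetI A A')],
      forall e, [/\ p (gset1 (src e)) ** s e = s e,
                    s e ** p (gset_rng e) = s e,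
                    p (gset_rng e) ** ss e = ss e &
                    ss e ** p (gset1 (src e)) = ss e],
      forall e f, ss e ** s f = if e == f then p (gset_rng e) else 0 &
      forall v (es : seq (edge G)),
        es <> [::] -> uniq es -> (forall e, e \in es <-> src e = v) ->
        p (gset1 v) = \sum_(e <- es) s e ** ss e].

Lemma leavittP : leavitt_family (@lP R G) (@lS R G) (@lSs R G).
Proof.
have relE t u : leavitt_rel t u ->
    tclass (@leavitt_rel R G) t = tclass (@leavitt_rel R G) u.
  by move=> tu; apply/tclassE/cong_rel.
rewrite /lP /lS /lSs; split.
- split=> [|A A'|A A'].
  + exact: relE (rel_P0 R G).
  + by rewrite -tclassM; exact/relE/rel_PI.
  + by rewrite (relE _ _ (rel_PU R A A')) !tclassD tclassZ scaleN1r.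
- move=> e; split; rewrite -tclassM; apply: relE.
  + exact: rel_srcS.
  + exact: rel_Srng.
  + exact: rel_rngSs.
  + exact: rel_Sssrc.
- move=> e f; rewrite -tclassM; case: eqP => [<-|ef].
  + exact/relE/rel_SsS.
  + by rewrite (relE _ _ (rel_SsS0 R ef)).
- move=> v es es0 ues esv; rewrite (relE _ _ (rel_CK R es0 ues esv)).
  elim: es {es0 ues esv} => [|e es IH] /=; first by rewrite big_nil.
  by rewrite big_cons tclassD tclassM IH.
Qed.

Lemma leavitt_universal (B : nuAlgType R) p s ss :
  @leavitt_family B p s ss ->
  exists! f : leavitt R G -> B,
    [/\ nu_hom f, forall A, f (lP R A) = p A,
        forall e, f (lS R e) = s e & forall e, f (lSs R e) = ss e].
Proof.
move=> [[p0 pI pU] ps sss CK].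
pose g x := match x with GenP A => p A | GenS e => s e | GenSs e => ss e end.
have [] := @presented_universal R _ (@leavitt_rel R G) B g.
  move=> t u; case=> /=.
  - exact: p0.
  - exact: pI.
  - by move=> A A'; rewrite scaleN1r; exact: pU.
  - by move=> e; case: (ps e).
  - by move=> e; case: (ps e).
  - by move=> e; case: (ps e).
  - by move=> e; case: (ps e).
  - by move=> e; rewrite sss eqxx.
  - by move=> e f /eqP/negPf ef; rewrite sss ef.
  - move=> v es es0 ues esv; rewrite (CK v es es0 ues esv).
    elim: es {es0 ues esv} => [|e es IH] /=; first by rewrite big_nil.
    by rewrite big_cons IH.
move=> f [[fh fg] fu]; exists f; split.
  by split=> // x; [exact: (fg (GenP x))|exact: (fg (GenS x))
                   |exact: (fg (GenSs x))].
by move=> h [hh hP hS hSs]; apply: fu; split=> // -[].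
Qed.

End LeavittUniversal.

(* Finitely supported families of coefficients indexed by the exponents; the
   ring structure of [monalg] is not available because its monomials may not
   have inverses. *)
Definition laurent (R : comNzRingType) : Type := {malg R[int]}.

Section Laurent.
Variable R : comNzRingType.
Implicit Types f g h : laurent R.

HB.instance Definition _ := GRing.Lmodule.copy (laurent R) {malg R[int]}.

Definition laurent1 : laurent R := << (1 : R) *g (0 : int) >>.

Definition laurent_mul f g : laurent R :=
  \sum_(i <- msupp f) \sum_(j <- msupp g) << f@_i * g@_j *g (i + j) >>.

Lemma laurent_mulw (d1 d2 : {fset int}) f g :
  (msupp f `<=` d1)%fset -> (msupp g `<=` d2)%fset ->
  laurent_mul f g =
    \sum_(i <- d1) \sum_(j <- d2) << f@_i * g@_j *g (i + j) >>.
Proof.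
move=> le1 le2; rewrite /laurent_mul (big_fset_incl _ le1) /=.
  apply/eq_bigr=> i _; apply/big_fset_incl => // j _ /mcoeff_outdom ->.
  by rewrite mulr0 monalgU0.
move=> i _ /mcoeff_outdom fi.
by rewrite big1 => // j _; rewrite fi mul0r monalgU0.
Qed.

Lemma laurent_mulC : commutative laurent_mul.
Proof.
move=> f g; rewrite /laurent_mul exchange_big /=.
apply: eq_bigr => j _; apply: eq_bigr => i _.
by rewrite mulrC addrC.
Qed.

Lemma laurent_mulDl : left_distributive laurent_mul +%R.
Proof.
move=> f g h; pose d := (msupp f `|` msupp g)%fset.
rewrite (@laurent_mulw d (msupp h) (f + g)) ?msuppD_le //.
rewrite (@laurent_mulw d (msupp h) f) ?fsubsetUl //.
rewrite (@laurent_mulw d (msupp h) g) ?fsubsetUr // -big_split /=.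
apply: eq_bigr => i _; rewrite -big_split /=; apply: eq_bigr => j _.
by rewrite mcoeffD mulrDl monalgUD.
Qed.

Lemma laurent_mulDr : right_distributive laurent_mul +%R.
Proof.
by move=> f g h; rewrite !(laurent_mulC f) laurent_mulDl.
Qed.

Lemma laurent_mulU (a b : R) (i j : int) :
  laurent_mul << a *g i >> << b *g j >> = << a * b *g (i + j) >>.
Proof.
rewrite (@laurent_mulw [fset i]%fset [fset j]%fset) ?msuppU_le //.
by rewrite !big_seq_fset1 !mcoeffUU.
Qed.

Lemma laurent_mul0 f : laurent_mul 0 f = 0.
Proof. by rewrite /laurent_mul msupp0 big_seq_fset0. Qed.

Lemma laurent_ind (P : laurent R -> Prop) :
  P 0 -> (forall f g, P f -> P g -> P (f + g)) ->
  (forall (a : R) (i : int), P << a *g i >>) -> forall f, P f.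
Proof.
by move=> P0 PD PU f; rewrite [f]monalgE; elim/big_ind: _.
Qed.

Lemma laurent_mulA : associative laurent_mul.
Proof.
move=> f g h.
elim/laurent_ind: f => [|f f' IH IH'|a i]; first by rewrite !laurent_mul0.
  by rewrite !laurent_mulDl IH IH'.
elim/laurent_ind: g => [|g g' IH IH'|b j].
- by rewrite laurent_mul0 [laurent_mul _ 0]laurent_mulC !laurent_mul0.
- by rewrite laurent_mulDl !laurent_mulDr laurent_mulDl IH IH'.
elim/laurent_ind: h => [|h h' IH IH'|c k].
- by do 3!rewrite [laurent_mul _ 0]laurent_mulC laurent_mul0.
- by rewrite !laurent_mulDr IH IH'.
by rewrite !laurent_mulU mulrA addrA.
Qed.

Lemma laurent_mul1 : left_id laurent1 laurent_mul.
Proof.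
elim/laurent_ind=> [|f g IH IH'|a i].
- by rewrite laurent_mulC laurent_mul0.
- by rewrite laurent_mulDr IH IH'.
- by rewrite laurent_mulU mul1r add0r.
Qed.

Lemma laurent1_neq0 : laurent1 != 0.
Proof. by rewrite monalgU_eq0 oner_neq0. Qed.

HB.instance Definition _ := GRing.Zmodule_isComNzRing.Build (laurent R)
  laurent_mulA laurent_mulC laurent_mul1 laurent_mulDl laurent1_neq0.

Lemma laurent_scaleU (a b : R) (i : int) :
  a *: (<< b *g i >> : laurent R) = << a * b *g i >>.
Proof. by apply/malgP=> k; rewrite mcoeffZ !mcoeffU mulrnAr. Qed.

Lemma laurent_scaleE (a : R) f : a *: f = laurent_mul << a *g 0 >> f.
Proof.
elim/laurent_ind: f => [|f g IH IH'|b i].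
- by rewrite scaler0 laurent_mulC laurent_mul0.
- by rewrite scalerDr laurent_mulDr IH IH'.
- by rewrite laurent_scaleU laurent_mulU add0r.
Qed.

Lemma laurent_scaleAl (a : R) f g : a *: (f * g) = (a *: f) * g.
Proof. by rewrite !laurent_scaleE; exact: laurent_mulA. Qed.

HB.instance Definition _ := GRing.Lmodule_isLalgebra.Build R (laurent R)
  laurent_scaleAl.

HB.instance Definition _ := GRing.Lalgebra_isComAlgebra.Build R (laurent R).

End Laurent.

(* Main.v *)
From HB Require Import structures.
Require Import Defs.
From mathcomp Require Import all_boot all_algebra.
From mathcomp Require Import finmap boolp classical_sets functions.
From mathcomp.multinomials Require Import monalg.

(** Everything reduces to three facts about the monomials
    $s_\alpha p_A s_\beta^*$, which span $L_R(\mathcal G)$ linearly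
    ([monospanT]).

    First, $L_R(\mathcal G)$ is graded by the free group on the edges, with
    $s_\alpha p_A s_\beta^*$ of degree $\alpha\beta^{-1}$, and the diagonal
    lies in degree $1$. Hence the homogeneous parts of an element centralising
    the diagonal centralise it too. The grading is realised by letting
    $L_R(\mathcal G)$ act on the functions from the free group to
    $L_R(\mathcal G)$, where $s_e$ also translates the argument
    ([graded_rep], [component_commute]).

    Second, $a p_A \neq 0$ for $a \neq 0$ and $A \neq \emptyset$
    ([scale_lP_eq0]). This is seen on functions on infinite paths.

    Third, a loop without exits starts at a vertex $v$ that is the source of
    only one infinite path. The corner $p_v L_R(\mathcal G) p_v$ is spanned by
    elements which go $m$ steps forward along this path and $n$ steps back;
    the product of two of them depends only on the sums of the $m$'s and of
    the $n$'s, so the corner is commutative ([nonbranching_corner]).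

    A homogeneous part $y$ of an element of the centraliser is
    $s_\alpha d s_\beta^*$ with $d$ in the diagonal and $\alpha$, $\beta$ without
    common last letter. If neither word is a prefix of the other, commuting
    with $s_\alpha s_\alpha^*$ gives $y = 0$ ([incomparable_component]). If
    $\alpha = \beta\lambda$, commuting with the cylinder projections
    of $\beta\lambda^k$ for large $k$ shows that, unless $y = 0$, $\lambda$ is a
    loop without exits and $y$ is a multiple of $s_{\beta\lambda} s_\beta^*$
    ([loop_component]). The case $\beta = \alpha\lambda$ follows by the involution, and $\alpha = \beta$
    is diagonal. So the centraliser is contained in the core. The generators
    of the core are $s_\beta z s_\beta^*$ with $z$ a vertex projection or an
    element of a commutative corner, and these commute ([conj_word_comm]); this
    gives the other inclusion and the commutativity of the core. Maximality
    follows, as the core contains the diagonal.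

    If the core is central, so are $p_{s(e)}$ and $s_e s_e^*$, which
    forces $r(e) = \{s(e)\}$ and $s_e s_e^* = p_{s(e)}$. A connected ultragraph
    then has one vertex and at most one edge, and the isomorphisms with $R$ and
    $R[x, x^{-1}]$ are those given by the universal property. *)

Set Implicit Arguments.
Unset Strict Implicit.
Unset Printing Implicit Defensive.

Import GRing.Theory.
Local Open Scope classical_set_scope.
Local Open Scope ring_scope.

(** * Auxiliary algebras *)

Section OppositeAlgebra.
Variables (R : comNzRingType) (A : nuAlgType R).

Definition opp_alg : Type := A.

HB.instance Definition _ := GRing.Lmodule.copy opp_alg A.

Definition opp_mul (x y : opp_alg) : opp_alg := (y : A) ** (x : A).

Lemma opp_mulA : associative opp_mul.
Proof. by move=> x y z; rewrite /opp_mul nmulA. Qed.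

Lemma opp_mulDl : left_distributive opp_mul +%R.
Proof. by move=> x y z; rewrite /opp_mul nmulDr. Qed.

Lemma opp_mulDr : right_distributive opp_mul +%R.
Proof. by move=> x y z; rewrite /opp_mul nmulDl. Qed.

Lemma opp_scaleAl (a : R) x y : a *: opp_mul x y = opp_mul (a *: x) y.
Proof. by rewrite /opp_mul nscaleAr. Qed.

Lemma opp_scaleAr (a : R) x y : a *: opp_mul x y = opp_mul x (a *: y).
Proof. by rewrite /opp_mul nscaleAl. Qed.

HB.instance Definition _ := Lmodule_isNonUnitalAlgebra.Build R opp_alg
  opp_mulA opp_mulDl opp_mulDr opp_scaleAl opp_scaleAr.

End OppositeAlgebra.

Section EndomorphismAlgebra.
Variables (R : comNzRingType) (V : lmodType R).

(** A representation of the Leavitt algebra on [V] is a homomorphism to this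
    algebra, so it can be produced by the universal property. *)
Record lend : Type := Lend {
  lend_fun :> V -> V;
  lend_linear : linear lend_fun }.

Lemma lendP (f g : lend) : (forall v, f v = g v) <-> f = g.
Proof.
split=> [fg|-> //]; case: f g fg => f fl [g gl] /= fg.
have fgE : f = g by apply/funext.
by case: _ / fgE gl => gl; congr Lend; exact: Prop_irrelevance.
Qed.

HB.instance Definition _ := gen_eqMixin lend.
HB.instance Definition _ := gen_choiceMixin lend.

Lemma lendD (f : lend) u v : f (u + v) = f u + f v.
Proof. by have := lend_linear f 1 u v; rewrite !scale1r. Qed.

Lemma lend0 (f : lend) : f 0 = 0.
Proof. by apply: (addrI (f 0)); rewrite -lendD !addr0. Qed.

Lemma lendZ (f : lend) (a : R) v : f (a *: v) = a *: f v.
Proof. by have := lend_linear f a v 0; rewrite lend0 !addr0. Qed.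

Fact lend_zero_linear : linear (fun _ : V => 0 : V).
Proof. by move=> a u v; rewrite scaler0 addr0. Qed.

Fact lend_add_linear (f g : lend) : linear (fun v => f v + g v).
Proof.
by move=> a u v; rewrite !lendD !lendZ scalerDr addrACA.
Qed.

Fact lend_scale_linear (c : R) (f : lend) : linear (fun v => c *: f v).
Proof.
by move=> a u v; rewrite lendD lendZ scalerDr !scalerA mulrC.
Qed.

Fact lend_mul_linear (f g : lend) : linear (fun v => f (g v)).
Proof. by move=> a u v; rewrite !lendD !lendZ. Qed.

Definition lend_zero := Lend lend_zero_linear.
Definition lend_add f g := Lend (lend_add_linear f g).
Definition lend_scale c f := Lend (lend_scale_linear c f).
Definition lend_opp f := lend_scale (- 1) f.
Definition lend_mul f g := Lend (lend_mul_linear f g).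

Fact lend_addA : associative lend_add.
Proof. by move=> f g h; apply/lendP=> v /=; rewrite addrA. Qed.
Fact lend_addC : commutative lend_add.
Proof. by move=> f g; apply/lendP=> v /=; rewrite addrC. Qed.
Fact lend_add0 : left_id lend_zero lend_add.
Proof. by move=> f; apply/lendP=> v /=; rewrite add0r. Qed.
Fact lend_addN : left_inverse lend_zero lend_opp lend_add.
Proof. by move=> f; apply/lendP=> v /=; rewrite scaleN1r addNr. Qed.

HB.instance Definition _ := GRing.isZmodule.Build lend
  lend_addA lend_addC lend_add0 lend_addN.

Fact lend_scaleA a b f : lend_scale a (lend_scale b f) = lend_scale (a * b) f.
Proof. by apply/lendP=> v /=; rewrite scalerA. Qed.
Fact lend_scale1 : left_id 1 lend_scale.
Proof. by move=> f; apply/lendP=> v /=; rewrite scale1r. Qed.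
Fact lend_scaleDr : right_distributive lend_scale +%R.
Proof. by move=> a f g; apply/lendP=> v /=; rewrite scalerDr. Qed.
Fact lend_scaleDl f : {morph lend_scale^~ f : a b / a + b}.
Proof. by move=> a b; apply/lendP=> v /=; rewrite scalerDl. Qed.

HB.instance Definition _ := GRing.Zmodule_isLmodule.Build R lend
  lend_scaleA lend_scale1 lend_scaleDr lend_scaleDl.

Fact lend_mulA : associative lend_mul.
Proof. by move=> f g h; apply/lendP. Qed.
Fact lend_mulDl : left_distributive lend_mul +%R.
Proof. by move=> f g h; apply/lendP. Qed.
Fact lend_mulDr : right_distributive lend_mul +%R.
Proof. by move=> f g h; apply/lendP=> v /=; rewrite lendD. Qed.
Fact lend_scaleAl (a : R) f g : a *: lend_mul f g = lend_mul (a *: f) g.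
Proof. by apply/lendP. Qed.
Fact lend_scaleAr (a : R) f g : a *: lend_mul f g = lend_mul f (a *: g).
Proof. by apply/lendP=> v /=; rewrite lendZ. Qed.

HB.instance Definition _ := Lmodule_isNonUnitalAlgebra.Build R lend
  lend_mulA lend_mulDl lend_mulDr lend_scaleAl lend_scaleAr.

Lemma lend_addE (f g : lend) v : (f + g) v = f v + g v. Proof. by []. Qed.
Lemma lend_scaleE (a : R) (f : lend) v : (a *: f) v = a *: f v.
Proof. by []. Qed.
Lemma lend_mulE (f g : lend) v : (f ** g) v = f (g v). Proof. by []. Qed.
Lemma lend_zeroE v : (0 : lend) v = 0. Proof. by []. Qed.
Lemma lend_sumE (I : Type) (r : seq I) (F : I -> lend) v :
  (\sum_(i <- r) F i) v = \sum_(i <- r) F i v.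
Proof. by elim/big_rec2: _ => [|i f g _ <-]; rewrite ?lend_zeroE ?lend_addE. Qed.

End EndomorphismAlgebra.

Section NonUnitalLemmas.
Variables (R : comNzRingType) (A : nuAlgType R).
Implicit Types x y z : A.

Lemma nmul0l x : 0 ** x = 0.
Proof. by rewrite -[X in X ** _](scale0r (0 : A)) -nscaleAl scale0r. Qed.
Lemma nmul0r x : x ** 0 = 0.
Proof. by rewrite -[X in _ ** X](scale0r (0 : A)) -nscaleAr scale0r. Qed.

Lemma nmul_suml (I : Type) (r : seq I) (P : pred I) (F : I -> A) x :
  (\sum_(i <- r | P i) F i) ** x = \sum_(i <- r | P i) F i ** x.
Proof.
by elim/big_rec2: _ => [|i y z _ <-]; rewrite ?nmul0l ?nmulDl.
Qed.
Lemma nmul_sumr (I : Type) (r : seq I) (P : pred I) (F : I -> A) x :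
  x ** (\sum_(i <- r | P i) F i) = \sum_(i <- r | P i) x ** F i.
Proof.
by elim/big_rec2: _ => [|i y z _ <-]; rewrite ?nmul0r ?nmulDr.
Qed.

Lemma gen_subalgebraP (X : set A) : subalgebra (gen_subalgebra X).
Proof.
split.
- by move=> B [[]].
- by move=> x y Bx By B BX; case: (BX) => -[_ D _ _ _]; apply: D; [apply: Bx|apply: By].
- by move=> a x Bx B BX; case: (BX) => -[_ _ Z _ _]; apply: Z; apply: Bx.
- by move=> x y Bx By B BX; case: (BX) => -[_ _ _ M _]; apply: M; [apply: Bx|apply: By].
Qed.

Lemma centraliser_subalgebra (X : set A) : subalgebra (centraliser X).
Proof.
split=> [y _|x y cx cy z Xz|a x cx z Xz|x y cx cy z Xz].
- by rewrite nmul0l nmul0r.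
- by rewrite nmulDl nmulDr cx // cy.
- by rewrite -nscaleAl -nscaleAr cx.
- by rewrite -nmulA cy // nmulA cx // nmulA.
Qed.

(** The elements commuting with a given one form a subalgebra, so commutation
    need only be tested on generators. *)
Lemma centraliser_gen (X : set A) :
  centraliser (gen_subalgebra X) = centraliser X.
Proof.
apply/seteqP; split=> x cx y.
  by move=> Xy; apply: cx; exact: sub_gen_smallest.
suff: gen_subalgebra X `<=` centraliser [set x].
  by move=> /[apply]/(_ x erefl) ->.
apply: smallest_sub; first exact: centraliser_subalgebra.
by move=> z Xz _ ->; rewrite cx.
Qed.

Lemma gen_subalgebra_commutative (X : set A) :
  commutative_set X -> commutative_set (gen_subalgebra X).
Proof.
move=> XC; suff H: gen_subalgebra X `<=` centraliser (gen_subalgebra X).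
  by move=> x y Xx; apply: H.
rewrite centraliser_gen; apply: smallest_sub.
  exact: centraliser_subalgebra.
by move=> x Xx y; apply: XC.
Qed.

End NonUnitalLemmas.

Section Unitization.
Variables (R : comNzRingType) (A : nuAlgType R).

(** Adjoining a unit gives the empty word a value: in the unitization
    $s_\alpha x s_\beta^*$ is a genuine product even when a word is empty. *)
Definition unitization : Type := (R^o * A)%type.

HB.instance Definition _ := GRing.Lmodule.copy unitization (R^o * A)%type.

Implicit Types u v w : unitization.

Definition unit_one : unitization := (1, 0).

Definition unit_mul u v : unitization :=
  ((u.1 : R) * v.1, (u.1 : R) *: v.2 + (v.1 : R) *: u.2 + u.2 ** v.2).

Fact unit_mulA : associative unit_mul.
Proof.
move=> [a x] [b y] [c z]; congr pair; rewrite /= ?mulrA //.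
rewrite !nmulDl !nmulDr !scalerDr -!nscaleAl -!nscaleAr nmulA !scalerA -!addrA.
rewrite [c * a]mulrC [c * b]mulrC; congr (_ + (_ + _)).
rewrite [RHS]addrCA [RHS]addrA [RHS]addrCA; congr (_ + _).
by rewrite -!addrA [RHS]addrCA; congr (_ + _); rewrite addrCA.
Qed.

Fact unit_mul1 : left_id unit_one unit_mul.
Proof.
by move=> [a x]; congr pair; rewrite /= ?mul1r // scale1r scaler0 nmul0l !addr0.
Qed.

Fact unit_mulr1 : right_id unit_one unit_mul.
Proof.
move=> [a x]; congr pair; rewrite /= ?mulr1 //.
by rewrite scale1r scaler0 nmul0r add0r addr0.
Qed.

Fact unit_mulDl : left_distributive unit_mul +%R.
Proof.
move=> [a x] [b y] [c z]; congr pair; rewrite /= ?mulrDl //.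
by rewrite nmulDl scalerDl scalerDr [X in X + _]addrACA [LHS]addrACA.
Qed.

Fact unit_mulDr : right_distributive unit_mul +%R.
Proof.
move=> [a x] [b y] [c z]; congr pair; rewrite /= ?mulrDr //.
by rewrite nmulDr scalerDl scalerDr [X in X + _]addrACA [LHS]addrACA.
Qed.

Fact unit_one_neq0 : unit_one != 0.
Proof. by apply/eqP => -[] /eqP; rewrite oner_eq0. Qed.

HB.instance Definition _ := GRing.Zmodule_isNzRing.Build unitization
  unit_mulA unit_mul1 unit_mulr1 unit_mulDl unit_mulDr unit_one_neq0.

Fact unit_scaleAl (a : R) u v : a *: (u * v) = (a *: u) * v.
Proof.
case: u v => [b x] [c y]; congr pair; rewrite /=; first exact: mulrA.
by rewrite !scalerDr nscaleAl !scalerA [c * a]mulrC.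
Qed.

HB.instance Definition _ := GRing.Lmodule_isLalgebra.Build R unitization
  unit_scaleAl.

Fact unit_scaleAr (a : R) u v : a *: (u * v) = u * (a *: v).
Proof.
case: u v => [b x] [c y]; congr pair; rewrite /=; first exact: mulrCA.
by rewrite !scalerDr nscaleAr !scalerA [b * a]mulrC.
Qed.

HB.instance Definition _ := GRing.Lalgebra_isAlgebra.Build R unitization
  unit_scaleAr.

Definition unit_inj (x : A) : unitization := (0, x).

Lemma unit_inj_inj : injective unit_inj.
Proof. by move=> x y []. Qed.

Lemma unit_inj0 : unit_inj 0 = 0. Proof. by []. Qed.

Lemma unit_injD x y : unit_inj (x + y) = unit_inj x + unit_inj y.
Proof. by congr pair; rewrite addr0. Qed.

Lemma unit_injZ (a : R) x : unit_inj (a *: x) = a *: unit_inj x.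
Proof. by congr pair; rewrite scaler0. Qed.

Lemma unit_injM x y : unit_inj (x ** y) = unit_inj x * unit_inj y.
Proof. by congr pair; rewrite /= ?mulr0 // !scale0r !add0r. Qed.

End Unitization.

(** * Words in the generators *)

Section Words.
Variables (R : comNzRingType) (G : ultragraph).

Local Notation L := (leavitt R G).
Local Notation U := (unitization L).
Local Notation iota := (@unit_inj R L).

Implicit Types (e f : edge G) (v w : vertex G) (A B : gset G).
Implicit Types (al be ga de : seq (edge G)).

Lemma gset_inj A B : sval A = sval B -> A = B.
Proof.
case: A B => [A gA] [B gB] /= AB; case: _ / AB gB => gB.
by congr exist; exact: Prop_irrelevance.
Qed.

Lemma gsetIC A B : gsetI A B = gsetI B A.
Proof. by apply: gset_inj; rewrite /= setIC. Qed.

Lemma gsetI_in A v : sval A v -> gsetI A (gset1 v) = gset1 v.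
Proof. by move=> Av; apply/gset_inj/setIidPr => _ ->. Qed.

Lemma gsetI_out A v : ~ sval A v -> gsetI A (gset1 v) = gset0 G.
Proof.
by move=> Av; apply/gset_inj/seteqP; split=> // w /= [Aw wv]; apply: Av; rewrite -wv.
Qed.

(** [uP], [us], [ut], [uS], [uT] are the unitization images of
    $p_A$, $s_e$, $s_e^*$, $s_\alpha$, $s_{\alpha^*}$. *)
Definition uP A : U := iota (lP R A).
Definition us e : U := iota (lS R e).
Definition ut e : U := iota (lSs R e).

Definition uS al : U := foldr (fun e u => us e * u) 1 al.
Definition uT al : U := foldr (fun e u => u * ut e) 1 al.

Lemma uS_cat al be : uS (al ++ be) = uS al * uS be.
Proof. by elim: al => [|e al IH] /=; rewrite ?mul1r // IH mulrA. Qed.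

Lemma uT_cat al be : uT (al ++ be) = uT be * uT al.
Proof. by elim: al => [|e al IH] /=; rewrite ?mulr1 // IH mulrA. Qed.

Lemma monomialE al A be : iota (monomial R al A be) = uS al * uP A * uT be.
Proof.
elim: al => [|e al IH] /=; last by rewrite unit_injM IH !mulrA.
rewrite mul1r; elim: be => [|e be IH] /=; first by rewrite mulr1.
by rewrite unit_injM IH !mulrA.
Qed.

Lemma uP0 : uP (gset0 G) = 0.
Proof. by rewrite /uP; case: (leavittP R G) => -[-> _ _] _ _ _. Qed.

Lemma uPI A B : uP A * uP B = uP (gsetI A B).
Proof. by rewrite -unit_injM; case: (leavittP R G) => -[_ -> _] _ _ _. Qed.

Lemma uPC A B : uP A * uP B = uP B * uP A.
Proof. by rewrite !uPI gsetIC. Qed.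

Lemma uPP A : uP A * uP A = uP A.
Proof. by rewrite uPI; congr uP; apply: gset_inj; rewrite /= setIid. Qed.

Lemma uP_src e : uP (gset1 (src e)) * us e = us e.
Proof. by rewrite -unit_injM; case: (leavittP R G) => _ /(_ e)[-> _ _ _]. Qed.

Lemma us_rng e : us e * uP (gset_rng e) = us e.
Proof. by rewrite -unit_injM; case: (leavittP R G) => _ /(_ e)[_ -> _ _]. Qed.

Lemma uP_rng e : uP (gset_rng e) * ut e = ut e.
Proof. by rewrite -unit_injM; case: (leavittP R G) => _ /(_ e)[_ _ -> _]. Qed.

Lemma ut_src e : ut e * uP (gset1 (src e)) = ut e.
Proof. by rewrite -unit_injM; case: (leavittP R G) => _ /(_ e)[_ _ _ ->]. Qed.

Lemma ut_us e f : ut e * us f = if e == f then uP (gset_rng e) else 0.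
Proof.
by rewrite -unit_injM; case: (leavittP R G) => _ _ -> _; case: eqP.
Qed.

Lemma uP_CK v e : (forall f, src f = v <-> f = e) ->
  uP (gset1 v) = us e * ut e.
Proof.
move=> ve; case: (leavittP R G) => _ _ _ /(_ v [:: e]) CK.
rewrite -unit_injM /uP CK ?big_seq1 // => f.
by rewrite inE; split=> [/eqP->|/ve ->//]; apply/ve.
Qed.

(** By $s_e = p_{s(e)} s_e$, a projection $p_A$ either fixes or kills any word
    that starts at a given vertex, according to whether the vertex is in $A$. *)
Lemma uPs_in A e : sval A (src e) -> uP A * us e = us e.
Proof. by move=> Ae; rewrite -uP_src mulrA uPI gsetI_in. Qed.

Lemma uPs_out A e : ~ sval A (src e) -> uP A * us e = 0.
Proof. by move=> Ae; rewrite -uP_src mulrA uPI gsetI_out // uP0 mul0r. Qed.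

Lemma utP_in A e : sval A (src e) -> ut e * uP A = ut e.
Proof. by move=> Ae; rewrite -ut_src -mulrA uPI gsetIC gsetI_in. Qed.

Lemma utP_out A e : ~ sval A (src e) -> ut e * uP A = 0.
Proof. by move=> Ae; rewrite -ut_src -mulrA uPI gsetIC gsetI_out // uP0 mulr0. Qed.

Lemma uPS_in A e al : sval A (src e) -> uP A * uS (e :: al) = uS (e :: al).
Proof. by move=> Ae; rewrite mulrA uPs_in. Qed.

Lemma uPS_out A e al : ~ sval A (src e) -> uP A * uS (e :: al) = 0.
Proof. by move=> Ae; rewrite mulrA uPs_out // mul0r. Qed.

Lemma uTP_in A e al : sval A (src e) -> uT (e :: al) * uP A = uT (e :: al).
Proof. by move=> Ae; rewrite -mulrA utP_in. Qed.

Lemma uTP_out A e al : ~ sval A (src e) -> uT (e :: al) * uP A = 0.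
Proof. by move=> Ae; rewrite -mulrA utP_out // mulr0. Qed.

(** The range projection $s_\alpha^* s_\alpha$; it is $1$ for the empty
    word and $0$ for a word which is not a path. *)
Definition uQ al : U :=
  if al is e :: al' then
    if upath al then uP (gset_rng (last e al')) else 0
  else 1.

Lemma upath_cons2 e f al :
  upath [:: e, f & al] = (src f \in rng e) && upath (f :: al).
Proof. by []. Qed.

Lemma uTS al : uT al * uS al = uQ al.
Proof.
elim: al => [|e [|f al] IH]; first exact: mulr1.
  by rewrite /= mulr1 mul1r ut_us eqxx.
rewrite -[uT _]/(uT (f :: al) * ut e) -[uS _]/(us e * uS (f :: al)).
rewrite mulrA -(mulrA _ (ut e)) ut_us eqxx -mulrA.
rewrite /uQ upath_cons2; case: (boolP (src f \in rng e)) => fe.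
  by rewrite uPS_in ?IH //; exact: set_mem.
by rewrite uPS_out ?mulr0 // => /mem_set; apply/negP.
Qed.

Lemma uTS_incomparable al be :
  ~~ prefix al be -> ~~ prefix be al -> uT al * uS be = 0.
Proof.
elim: al be => [|e al IH] [|f be] //=.
rewrite -!mulrA (mulrA (ut e)) ut_us [f == e]eq_sym.
case: eqP => [_|_] /=; last by rewrite mul0r mulr0.
case: be => [|g be]; first by rewrite prefix0s.
move=> ab ba; case: (asboolP (rng e (src g))) => eg.
  by rewrite uPS_in //; apply: IH.
by rewrite uPS_out ?mulr0.
Qed.

Lemma uS_npath al : ~~ upath al -> uS al = 0.
Proof.
elim: al => [|e [|f al] IH] //; rewrite upath_cons2.
rewrite -[uS _]/(us e * uS (f :: al)).
case: (boolP (src f \in rng e)) => fe nf; first by rewrite (IH nf) mulr0.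
rewrite -us_rng -mulrA uPS_out ?mulr0 //.
by move=> /mem_set; apply/negP.
Qed.

Lemma uT_npath al : ~~ upath al -> uT al = 0.
Proof.
elim: al => [|e [|f al] IH] //; rewrite upath_cons2.
rewrite -[uT _]/(uT (f :: al) * ut e).
case: (boolP (src f \in rng e)) => fe nf; first by rewrite (IH nf) mul0r.
rewrite -uP_rng mulrA uTP_out ?mul0r //.
by move=> /mem_set; apply/negP.
Qed.

Lemma uS_last e al : uS (e :: al) * uP (gset_rng (last e al)) = uS (e :: al).
Proof.
elim/last_ind: al => [|al f _]; first by rewrite /= mulr1 us_rng.
by rewrite last_rcons -cats1 -cat_cons uS_cat -mulrA /= mulr1 us_rng.
Qed.

Lemma uT_last e al : uP (gset_rng (last e al)) * uT (e :: al) = uT (e :: al).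
Proof.
elim/last_ind: al => [|al f _]; first by rewrite /= mul1r uP_rng.
by rewrite last_rcons -cats1 -cat_cons uT_cat mulrA [uT [:: f]]/= mul1r uP_rng.
Qed.

Lemma uSQ al : uS al * uQ al = uS al.
Proof.
case: al => [|e al]; first by rewrite mulr1.
rewrite /uQ; case: ifPn => [_|/uS_npath->]; first exact: uS_last.
by rewrite mul0r.
Qed.

Lemma uQT al : uQ al * uT al = uT al.
Proof.
case: al => [|e al]; first by rewrite mul1r.
rewrite /uQ; case: ifPn => [_|/uT_npath->]; first exact: uT_last.
by rewrite mulr0.
Qed.

Lemma uQQ al : uQ al * uQ al = uQ al.
Proof. by rewrite -{2}uTS mulrA uQT uTS. Qed.

(** All values of [uQ] and [uP]: with this common notion the empty word, the
    paths and the words that are not paths need no separate treatment. *)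
Definition vertexlike (q : U) := q = 0 \/ q = 1 \/ exists A, q = uP A.

Lemma vertexlikeQ al : vertexlike (uQ al).
Proof.
case: al => [|e al]; first by right; left.
by rewrite /uQ; case: ifP => _; [right; right; eexists|left].
Qed.

Lemma vertexlikeP A : vertexlike (uP A).
Proof. by right; right; exists A. Qed.

Lemma vertexlike_S q e al : vertexlike q ->
  q * uS (e :: al) = 0 \/ q * uS (e :: al) = uS (e :: al).
Proof.
case=> [->|[->|[A ->]]]; rewrite ?mul0r ?mul1r; [by left|by right|].
case: (asboolP (sval A (src e))) => Ae; first by right; rewrite uPS_in.
by left; rewrite uPS_out.
Qed.

(** Admissibility can be ignored when showing that a monomial lies in the
    diagonal or in the core: a monomial that is not admissible vanishes. *)
Lemma monomial_neq0_admissible al A be :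
  monomial R al A be <> 0 -> admissible al A be.
Proof.
move=> m0; have u0 : uS al * uP A * uT be <> 0.
  by rewrite -monomialE -unit_inj0 => /unit_inj_inj.
have ual : upath al.
  by apply: contra_notT u0 => /uS_npath->; rewrite !mul0r.
have ube : upath be.
  by apply: contra_notT u0 => /uT_npath->; rewrite !mulr0.
split=> //; apply: contra_notP u0 => nz.
have E0 B : sval B `<=` urange al `&` sval A `&` urange be -> uP B = 0.
  move=> sB; rewrite -uP0; congr uP; apply/gset_inj/seteqP; split=> //= v /sB.
  by move=> vB; case: nz; exists v.
rewrite -(uSQ al) -(uQT be) !mulrA -[uS al * _ * _]mulrA -[uS al * _ * _]mulrA.
suff -> : uQ al * uP A * uQ be = 0 by rewrite mulr0 mul0r.
case: al ual be ube {m0 nz} E0 => [|e al] ual [|f be] ube E0.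
- by rewrite /= mul1r mulr1; apply: E0 => v /= Av; split; first split.
- rewrite /uQ ube mul1r uPI; apply: E0 => v /= [Av vf]; split=> //; split=> //.
- rewrite /uQ ual mulr1 uPI; apply: E0 => v /= [ve Av]; split=> //; split=> //.
- by rewrite /uQ ual ube !uPI; apply: E0 => v /= [[]].
Qed.

(** $L_R(\mathcal G)$ has no unit in general, but a term involves finitely
    many vertex sets and their union acts as one. *)
Lemma right_local_unit (x : L) : exists A, x ** lP R A = x.
Proof.
have PU A B : lP R A ** lP R (gsetU A B) = lP R A.
  case: (leavittP R G) => -[_ -> _] _ _ _; congr lP; apply: gset_inj.
  by apply/setIidPl => v; left.
have PU' A B : lP R B ** lP R (gsetU A B) = lP R B.
  by rewrite -[RHS](PU B A); congr (_ ** lP R _); apply: gset_inj; rewrite /= setUC.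
have mono (y : L) A B : y ** lP R A = y -> y ** lP R (gsetU A B) = y.
  by move=> <-; rewrite -nmulA PU.
have mono' (y : L) A B : y ** lP R B = y -> y ** lP R (gsetU A B) = y.
  by move=> <-; rewrite -nmulA PU'.
elim/tclass_ind: x => t; elim: t => [[A|e|e]||t [A tA] u [B uB]|a t [A tA]|t _ u [B uB]].
- exists A; rewrite -/(lP R A).
  by apply: unit_inj_inj; rewrite unit_injM uPP.
- exists (gset_rng e); rewrite -/(lS R e).
  by apply: unit_inj_inj; rewrite unit_injM us_rng.
- exists (gset1 (src e)); rewrite -/(lSs R e).
  by apply: unit_inj_inj; rewrite unit_injM ut_src.
- by exists (gset0 G); rewrite tclass0 nmul0l.
- by exists (gsetU A B); rewrite tclassD nmulDl mono // mono'.
- by exists A; rewrite tclassZ -nscaleAl tA.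
- by exists B; rewrite tclassM -nmulA uB.
Qed.

(** * Linear spanning by monomials *)

Definition mono : Type := (seq (edge G) * gset G * seq (edge G))%type.

Definition lmono (m : mono) : L := monomial R m.1.1 m.1.2 m.2.

Definition monosum (s : seq (R * mono)) : L :=
  \sum_(i <- s) i.1 *: lmono i.2.

Definition monospan : set L := [set x | exists s, x = monosum s].

Lemma monospan0 : monospan 0.
Proof. by exists [::]; rewrite /monosum big_nil. Qed.

Lemma monospanD x y : monospan x -> monospan y -> monospan (x + y).
Proof. by move=> [s ->] [s' ->]; exists (s ++ s'); rewrite /monosum big_cat. Qed.

Lemma monospanZ (a : R) x : monospan x -> monospan (a *: x).
Proof.
move=> [s ->]; exists [seq (a * i.1, i.2) | i <- s].
by rewrite /monosum scaler_sumr big_map; apply: eq_bigr => i _; rewrite scalerA.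
Qed.

Lemma monospan_mono al A be : monospan (monomial R al A be).
Proof. by exists [:: (1, (al, A, be))]; rewrite /monosum big_seq1 scale1r. Qed.

Lemma monospanP al A be (x : L) :
  iota x = uS al * uP A * uT be -> monospan x.
Proof. by rewrite -monomialE => /unit_inj_inj->; exact: monospan_mono. Qed.

Lemma monospan_Pmul B al A be : monospan (lP R B ** monomial R al A be).
Proof.
case: al => [|e al].
  apply: (@monospanP [::] (gsetI B A) be).
  by rewrite unit_injM monomialE !mul1r mulrA uPI.
case: (asboolP (sval B (src e))) => Be.
  apply: (@monospanP (e :: al) A be).
  by rewrite unit_injM monomialE !mulrA -[_ * _ * uS al]mulrA uPS_in.
suff -> : lP R B ** monomial R (e :: al) A be = 0 by exact: monospan0.
apply: unit_inj_inj; rewrite unit_injM monomialE !mulrA -[_ * _ * uS al]mulrA.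
by rewrite uPS_out // !mul0r.
Qed.

(** A generator times a monomial reduces to a monomial or $0$: multiplying by
    $s_e^*$ cancels the first letter of $\alpha$, or extends $\beta$ if
    $\alpha$ is empty. *)
Lemma monospan_genmul (x : leavitt_gen G) y :
  monospan y -> monospan (tclass (@leavitt_rel R G) (TGen x) ** y).
Proof.
move=> [s ->]; rewrite nmul_sumr; elim/big_ind: _ => [||[a [[al A] be]] _].
- exact: monospan0.
- exact: monospanD.
rewrite -nscaleAr; apply: monospanZ; rewrite /lmono /=.
case: x => [B|e|e]; first exact: monospan_Pmul.
  exact: (@monospan_mono (e :: al)).
rewrite -/(lSs R e); case: al => [|f al].
  case: (asboolP (sval A (src e))) => Ae.
    apply: (@monospanP [::] (gset_rng e) (be ++ [:: e])).
    rewrite unit_injM monomialE !mul1r -/(ut e) uT_cat /= mul1r !mulrA uP_rng.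
    by rewrite utP_in.
  suff -> : lSs R e ** monomial R [::] A be = 0 by exact: monospan0.
  apply: unit_inj_inj; rewrite unit_injM monomialE mul1r -/(ut e) !mulrA.
  by rewrite utP_out // mul0r.
have -> : lSs R e ** monomial R (f :: al) A be =
          if e == f then lP R (gset_rng e) ** monomial R al A be else 0.
  apply: unit_inj_inj; rewrite (fun_if iota) !unit_injM !monomialE -/(ut e) /=.
  by rewrite !mulrA ut_us; case: eqP => // _; rewrite !mul0r.
by case: eqP => _; [exact: monospan_Pmul|exact: monospan0].
Qed.

Lemma monospanT (x : L) : monospan x.
Proof.
have [A <-] := right_local_unit x.
have := @monospan_mono [::] A [::]; rewrite [monomial _ _ _ _]/=.
elim/tclass_ind: x (lP R A) => t; elim: t => [g||t IHt u IHu|a t IH|t IHt u IHu] y my.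
- exact: monospan_genmul.
- by rewrite tclass0 nmul0l; exact: monospan0.
- by rewrite tclassD nmulDl; apply: monospanD; [exact: IHt|exact: IHu].
- by rewrite tclassZ -nscaleAl; apply/monospanZ/IH.
- by rewrite tclassM -nmulA; apply/IHt/IHu.
Qed.

End Words.

(** * The involution *)

Section Involution.
Variables (R : comNzRingType) (G : ultragraph).
Local Notation L := (leavitt R G).

(** The relations are invariant under exchanging $s_e$ and $s_e^*$ and
    reversing products, so the universal property gives a homomorphism to the
    opposite algebra. It turns statements about $\alpha = \beta\lambda$ into
    statements about $\beta = \alpha\lambda$. *)
Lemma leavitt_involution : exists st : L -> L,
  [/\ forall x y, st (x + y) = st x + st y,
      forall (a : R) x, st (a *: x) = a *: st x,
      forall x y, st (x ** y) = st y ** st x &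
      forall al A be, st (monomial R al A be) = monomial R be A al].
Proof.
have [[p0 pI pU] ps sss CK] := leavittP R G.
have [|st [[[stD stZ stM] stP stS stSs] _]] :=
  @leavitt_universal R G (opp_alg L) (@lP R G) (@lSs R G) (@lS R G).
  split.
  - split=> // A A'; rewrite -[LHS]/(lP R A' ** lP R A) pI.
    by congr lP; rewrite gsetIC.
  - by move=> e; have [h1 h2 h3 h4] := ps e; split.
  - move=> e f; rewrite -[LHS]/(lSs R f ** lS R e) sss eq_sym.
    by case: eqP => // ->.
  - exact: CK.
exists st; split=> // al A be.
apply: unit_inj_inj; rewrite monomialE.
have stM' (x y : L) : st (x ** y) = (st y : L) ** (st x : L) by exact: stM.
suff -> : st (monomial R al A be) = foldr (fun e x => x ** lSs R e)
    (foldr (fun e x => lS R e ** x) (lP R A) be) al.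
  elim: al => [|e al IH] /=; last by rewrite unit_injM IH mulrA.
  by rewrite mulr1; elim: be => [|e be IH] /=; rewrite ?mul1r // unit_injM IH mulrA.
elim: al => [|e al IH] /=; last by rewrite stM' IH stS.
by elim: be => [|e be IH] /=; rewrite ?stP // stM' IH stSs.
Qed.

End Involution.

(** * Vertex projections are torsion-free *)

Section PathRepresentation.
Variables (R : comNzRingType) (G : ultragraph).
Local Notation step := (edge G + vertex G)%type.

Definition step_src (y : step) : vertex G :=
  match y with inl e => src e | inr v => v end.

(** A sink $w$ is made to carry a formal loop [inr w]; then every vertex is the
    source of an infinite path and no finite boundary paths are needed. *)
Definition follows (y z : step) : Prop :=
  match y with
  | inl e => rng e (step_src z)
  | inr v => sink v /\ z = inr v
  end.

Definition follows_all (x : nat -> step) : Prop :=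
  forall i, follows (x i) (x i.+1).

Definition bpath : Type := {x : nat -> step | follows_all x}.

Implicit Types x : bpath.

Definition bhead x : step := sval x 0%N.
Definition bsrc x : vertex G := step_src (bhead x).
Definition btail x : bpath :=
  exist follows_all (fun i => sval x i.+1) (fun i => svalP x i.+1).

Lemma bpath_inj x x' : sval x =1 sval x' -> x = x'.
Proof.
case: x x' => [x hx] [x' hx'] /= /funext xx'; case: _ / xx' hx' => hx'.
by congr exist; exact: Prop_irrelevance.
Qed.

Definition bcons_fun e x (i : nat) : step :=
  if i is j.+1 then sval x j else inl e.

Lemma bcons_follows e x : rng e (bsrc x) -> follows_all (bcons_fun e x).
Proof. by move=> ex [|i] //=; exact: (svalP x). Qed.

Definition bcons e x : bpath :=
  match pselect (rng e (bsrc x)) with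
  | left ex => exist follows_all _ (bcons_follows ex)
  | right _ => x
  end.

Lemma bhead_cons e x : rng e (bsrc x) -> bhead (bcons e x) = inl e.
Proof. by rewrite /bcons; case: pselect. Qed.

Lemma btail_cons e x : rng e (bsrc x) -> btail (bcons e x) = x.
Proof. by rewrite /bcons; case: pselect => // ex _; apply: bpath_inj. Qed.

Lemma bsrc_tail e x : bhead x = inl e -> rng e (bsrc (btail x)).
Proof. by rewrite /bhead => xe; have := svalP x 0%N; rewrite xe. Qed.

Lemma bcons_tail e x : bhead x = inl e -> bcons e (btail x) = x.
Proof.
move=> xe; apply: bpath_inj => i; rewrite /bcons.
case: pselect => [?|/(_ (bsrc_tail xe))//] /=.
by case: i => //=; rewrite -xe.
Qed.

Lemma exists_bpath v : exists x, bsrc x = v.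
Proof.
have /choice[nx nxP] : forall w : vertex G, exists y : step,
    step_src y = w /\ (forall u, y = inr u -> sink u).
  move=> w; case: (pselect (exists e, src e = w)) => [[e ew]|nw].
    by exists (inl e).
  by exists (inr w); split=> // u [<-] e ew; apply: nw; exists e.
have /choice[pr prP] : forall e : edge G, exists w, rng e w.
  by move=> e; have [w] := rng_neq0 e; exists w.
pose nxt (y : step) : step :=
  match y with inl e => nx (pr e) | inr u => inr u end.
pose x i := iter i nxt (nx v).
have xs i u : x i = inr u -> sink u.
  elim: i u => [|i IH] u; first by move/(nxP v).2.
  rewrite /x iterS -/(x i); case: (x i) IH => [e _|w IH] /=.
    by move/(nxP (pr e)).2.
  exact: IH.
have xv i : follows (x i) (x i.+1).
  rewrite /x iterS -/(x i); case E: (x i) => [e|w] /=.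
    by rewrite (nxP (pr e)).1; exact: prP.
  by split=> //; apply: xs E.
by exists (exist follows_all x xv); rewrite /bsrc /bhead /= (nxP v).1.
Qed.

Local Notation V := (bpath -> R^o).

Definition bP (A : gset G) (h : V) : V :=
  fun x => if `[< sval A (bsrc x) >] then h x else 0.
(** The Leavitt algebra acts on functions on the infinite paths as for a
    branching system: $s_e$ transports functions along $x \mapsto ex$. *)
Definition bS e (h : V) : V :=
  fun x => if bhead x == inl e then h (btail x) else 0.
Definition bSs e (h : V) : V :=
  fun x => if `[< rng e (bsrc x) >] then h (bcons e x) else 0.

Lemma bP_linear A : linear (bP A).
Proof.
move=> a f g; apply/funext=> x; rewrite /bP -[RHS]/(a *: _ + _).
by case: ifP => _ //; rewrite scaler0 addr0.
Qed.
Lemma bS_linear e : linear (bS e).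
Proof.
move=> a f g; apply/funext=> x; rewrite /bS -[RHS]/(a *: _ + _).
by case: ifP => _ //; rewrite scaler0 addr0.
Qed.
Lemma bSs_linear e : linear (bSs e).
Proof.
move=> a f g; apply/funext=> x; rewrite /bSs -[RHS]/(a *: _ + _).
by case: ifP => _ //; rewrite scaler0 addr0.
Qed.

Lemma path_family : @leavitt_family R G (lend V)
  (fun A => Lend (bP_linear A)) (fun e => Lend (bS_linear e))
  (fun e => Lend (bSs_linear e)).
Proof.
split; first split.
- apply/lendP=> h; apply/funext=> x /=; rewrite /bP.
  by case: asboolP.
- move=> A B; apply/lendP=> h; apply/funext=> x /=; rewrite /bP /= asbool_and.
  by case: asboolP; case: asboolP.
- move=> A B; apply/lendP=> h; apply/funext=> x /=.
  rewrite -[RHS]/(bP A h x + bP B h x + (-1) *: bP (gsetI A B) h x).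
  rewrite /bP /= asbool_and asbool_or scaleN1r.
  by case: asboolP; case: asboolP => _ _ /=; rewrite ?subr0 ?addr0 ?add0r ?addrK // subrr.
- move=> e; split; apply/lendP=> h; apply/funext=> x /=.
  + rewrite /bP /bS /bsrc; case: eqP => [->|_] /=; last by case: ifP.
    by case: asboolP.
  + rewrite /bS; case: eqP => // xe; rewrite /bP.
    by case: asboolP => // /(_ (bsrc_tail xe)).
  + by rewrite /bP /bSs /=; case: asboolP.
  + rewrite /bSs /bP; case: asboolP => // ex.
    by rewrite /bsrc bhead_cons //=; case: asboolP.
- move=> e f; case: eqP => [<-|ef]; apply/lendP=> h; apply/funext=> x /=.
    rewrite /bSs /bS /bP /=; case: asboolP => // ex.
    by rewrite bhead_cons // eqxx btail_cons.
  rewrite /bSs /bS; case: asboolP => // ex; rewrite bhead_cons //.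
  by case: eqP => // -[].
- move=> v es es0 ues esv; apply/lendP=> h; apply/funext=> x.
  rewrite lend_sumE fct_sumE /= /bP.
  have sE e : bS e (bSs e h) x = if bhead x == inl e then h x else 0.
    rewrite /bS; case: eqP => // xe; rewrite /bSs bcons_tail //.
    by case: asboolP => // /(_ (bsrc_tail xe)).
  under eq_bigr => e _ do rewrite sE.
  case xE: (bhead x) => [e|w].
    case: asboolP => /=; rewrite /bsrc xE /= => ev.
      have /esv ees : src e = v by [].
      rewrite (big_rem e) //= eqxx big_seq big1 ?addr0 // => f.
      by rewrite mem_rem_uniq // inE => /andP[fe _]; case: eqP => // -[ef]; rewrite ef eqxx in fe.
    rewrite big_seq big1 // => f /esv fv; case: eqP => // -[ef].
    by case: ev; rewrite ef.
  rewrite big1 //.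
  case: asboolP => //; rewrite /bsrc xE /= => wv.
  have := svalP x 0%N; rewrite -[sval x 0%N]/(bhead x) xE => -[sw _].
  case: es es0 ues esv => // e es _ _ /(_ e)[/(_ (mem_head _ _)) ev _].
  by case: (sw e); rewrite wv.
Qed.

(** The representation sends $a p_v$ to $a$ times the indicator of the paths
    that start at $v$, and there is such a path. *)
Lemma scale_lP1_eq0 (a : R) (v : vertex G) : a *: lP R (gset1 v) = 0 -> a = 0.
Proof.
have [phi [[[phiD phiZ phiM] phiP _ _] _]] := leavitt_universal path_family.
move=> av0; have [x xv] := exists_bpath v.
have := phiZ a (lP R (gset1 v)); rewrite av0 phiP.
have -> : phi 0 = 0 by apply: (addrI (phi 0)); rewrite -phiD !addr0.
move=> /(congr1 (fun f : lend V => f (fun=> 1) x)).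
rewrite lend_zeroE lend_scaleE /= -[RHS]/(a *: bP (gset1 v) _ x) /bP.
case: asboolP => [_|/(_ xv)//].
by rewrite -[RHS]/(a * 1) mulr1 => <-.
Qed.

Lemma scale_lP_eq0 (a : R) (A : gset G) : sval A !=set0 -> a *: lP R A = 0 -> a = 0.
Proof.
move=> [v Av] aA; apply: (@scale_lP1_eq0 _ v).
apply: unit_inj_inj; rewrite unit_injZ -/(uP _ _) -(gsetI_in Av) -uPI scalerAl.
by rewrite -unit_injZ aA unit_inj0 mul0r.
Qed.

End PathRepresentation.

(** * The grading by the free group on the edges *)

Section ReducedWords.
Variable E : eqType.
Local Notation letter := (bool * E)%type.
Implicit Types (a : letter) (w : seq letter) (al be ga : seq E).

Definition linv a : letter := (~~ a.1, a.2).

Lemma linvK : involutive linv.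
Proof. by move=> [b e]; rewrite /linv /= negbK. Qed.

Definition reduced w : bool := sorted (fun a b => b != linv a) w.

(** Left multiplication by a letter in the free group, on reduced words *)
Definition push a w : seq letter :=
  if w is b :: w' then if b == linv a then w' else a :: w else [:: a].

Lemma push_reduced a w : reduced w -> reduced (push a w).
Proof.
case: w => [|b w] //= bw; case: ifP => [_|/negbT ba /=]; first exact: path_sorted bw.
by rewrite ba.
Qed.

Lemma pushK a w : reduced w -> push (linv a) (push a w) = w.
Proof.
case: w => [|b w] /=; first by rewrite linvK eqxx.
case: ifP => [/eqP->|ba _] /=; last by rewrite linvK eqxx.
by case: w => [|c w] //= /andP[/negbTE->].
Qed.

Definition rword : Type := {w : seq letter | reduced w}.

Definition rpush a (w : rword) : rword :=
  exist (fun w => reduced w) _ (push_reduced a (valP w)).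

Lemma rpushK a : cancel (rpush a) (rpush (linv a)).
Proof. by move=> w; apply: val_inj; rewrite /= pushK //; exact: (valP w). Qed.

Definition rnil : rword := exist (fun w => reduced w) [::] isT.

(** The element $\alpha\beta^{-1}$ of the free group *)
Definition pairword al be : rword :=
  foldr (fun e => rpush (true, e)) (foldl (fun (w : rword) e => rpush (false, e) w) rnil be) al.

(** A common last letter of $\alpha$ and $\beta$ cancels in
    $\alpha\beta^{-1}$. *)
Lemma pairword_rcons al be e :
  pairword (rcons al e) (rcons be e) = pairword al be.
Proof.
by rewrite /pairword foldr_rcons foldl_rcons (rpushK (false, e)).
Qed.

Lemma pairword_neg be :
  val (foldl (fun (w : rword) e => rpush (false, e) w) rnil be)
  = rev [seq (false, e) | e <- be].
Proof.
elim/last_ind: be => [|be e IH] //.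
rewrite foldl_rcons map_rcons rev_rcons /= IH.
by case: (lastP be) => [|{IH}be f] //; rewrite map_rcons rev_rcons.
Qed.

Lemma pairword_reduced al be :
    (forall al' be' e, ~ (al = rcons al' e /\ be = rcons be' e)) ->
  val (pairword al be)
  = [seq (true, e) | e <- al] ++ rev [seq (false, e) | e <- be].
Proof.
elim: al => [|e al IH] nc; first exact: pairword_neg.
rewrite /pairword /= -/(pairword al be) IH; last first.
  by move=> al' be' f [ale bee]; apply: (nc (e :: al') be' f); rewrite ale.
case: al nc {IH} => [|f al] nc //=.
case: (lastP be) nc => [|be' f] nc //; rewrite map_rcons rev_rcons /=.
case: eqP => // -[fe]; exfalso.
by apply: (nc [::] be' f); rewrite fe.
Qed.

Lemma pairword_diag al : pairword al al = rnil.
Proof.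
by elim/last_ind: al => [|al e IH] //; rewrite pairword_rcons.
Qed.

Definition signed_part (b : bool) w : seq E :=
  [seq a.2 | a <- w & a.1 == b].

Definition pos_part (w : rword) : seq E := signed_part true (val w).
Definition neg_part (w : rword) : seq E := rev (signed_part false (val w)).

Lemma signed_part_map (b b' : bool) al :
  signed_part b [seq (b', e) | e <- al] = if b' == b then al else [::].
Proof.
rewrite /signed_part; elim: al => [|e al IH]; first by case: ifP.
by rewrite /=; case: ifP IH => _ /= ->.
Qed.

Lemma parts_reduced al be :
    (forall al' be' e, ~ (al = rcons al' e /\ be = rcons be' e)) ->
  pos_part (pairword al be) = al /\ neg_part (pairword al be) = be.
Proof.
move=> nc; rewrite /pos_part /neg_part (pairword_reduced nc).
rewrite /signed_part !filter_cat !map_cat -!/(signed_part _ _) -!map_rev.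
by rewrite !signed_part_map /= cats0 revK.
Qed.

(** The degree determines the pair obtained from $(\alpha, \beta)$ by deleting
    the longest common suffix: it is read off from the positive and the
    negative letters of the reduced word. *)
Lemma pairword_split al be : exists ga,
  al = pos_part (pairword al be) ++ ga /\ be = neg_part (pairword al be) ++ ga.
Proof.
have reducedP al' be' :
    (forall al1 be1 e, ~ (al' = rcons al1 e /\ be' = rcons be1 e)) ->
    exists ga, al' = pos_part (pairword al' be') ++ ga /\
               be' = neg_part (pairword al' be') ++ ga.
  by move=> /parts_reduced[-> ->]; exists [::]; rewrite !cats0.
elim/last_ind: al be => [|al e IH] be.
  by apply: reducedP => -[|? ?] ? ? [].
case: (lastP be) => [|be' f].
  by apply: reducedP => ? [|? ?] ? [].
case: (eqVneq e f) => [<-|ef].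
  have [ga [alE beE]] := IH be'.
  by exists (rcons ga e); rewrite pairword_rcons -!rcons_cat -alE -beE.
apply: reducedP => al1 be1 g [/rcons_inj[_ eg] /rcons_inj[_ fg]].
by rewrite eg fg eqxx in ef.
Qed.

End ReducedWords.

Section Grading.
Variables (R : comNzRingType) (G : ultragraph).
Local Notation L := (leavitt R G).
Local Notation I := (rword (edge G)).
Local Notation V := (I -> L).

Definition gmul (x : L) (w : I -> I) (f : V) : V := fun k => x ** f (w k).

Lemma gmul_linear x w : linear (gmul x w).
Proof.
move=> a f g; apply/funext=> k.
by rewrite /gmul -[RHS]/(a *: _ + _) nscaleAr -nmulDr.
Qed.

Definition lgmul x w : lend V := Lend (gmul_linear x w).

(** [push (false, e)] is left multiplication by $e^{-1}$: translating the
    argument by it makes $s_e$ homogeneous of degree $e$. *)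
Lemma graded_family : @leavitt_family R G (lend V)
  (fun A => lgmul (lP R A) id) (fun e => lgmul (lS R e) (rpush (false, e)))
  (fun e => lgmul (lSs R e) (rpush (true, e))).
Proof.
have [[p0 pI pU] ps sss CK] := leavittP R G.
split; first split.
- by apply/lendP=> h; apply/funext=> x; rewrite /= /gmul p0 nmul0l.
- by move=> A B; apply/lendP=> h; apply/funext=> x; rewrite /= /gmul nmulA pI.
- move=> A B; apply/lendP=> h; apply/funext=> x; rewrite /= /gmul pU !nmulDl.
  by rewrite -[RHS]/(_ + _ + (-1) *: _) nscaleAl scaleN1r.
- move=> e; have [h1 h2 h3 h4] := ps e.
  by split; apply/lendP=> h; apply/funext=> x; rewrite /= /gmul nmulA ?h1 ?h2 ?h3 ?h4.
- move=> e f; apply/lendP=> h; apply/funext=> x; rewrite /= /gmul nmulA sss.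
  by case: eqP => [<-|_] /=; rewrite ?nmul0l // (rpushK (true, e)).
- move=> v es es0 ues esv; apply/lendP=> h; apply/funext=> x.
  rewrite lend_sumE fct_sumE /= /gmul (CK v es es0 ues esv) nmul_suml.
  by apply: eq_bigr => e _; rewrite /= /gmul (rpushK (false, e)) nmulA.
Qed.

Definition gdelta (w : I) (l : L) : V := fun k => if k == w then l else 0.

(** The vectors $\delta_w \otimes l$ make degrees visible: a monomial of
    degree $g$ moves the support point $1$ to $g$, and a diagonal monomial,
    being of degree $1$, acts pointwise. *)
Lemma graded_rep : exists phi : L -> lend V,
  [/\ nu_hom phi,
      forall al A be l, phi (monomial R al A be) (gdelta (rnil _) l)
        = gdelta (pairword al be) (monomial R al A be ** l) &
      forall ga A f k, phi (monomial R ga A ga) f k = monomial R ga A ga ** f k].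
Proof.
have [phi [[[phiD phiZ phiM] phiP phiS phiSs] _]] :=
  leavitt_universal graded_family.
have mulE (a : bool * edge G) (x : L) w l :
    gmul x (rpush (linv a)) (gdelta w l) = gdelta (rpush a w) (x ** l).
  apply/funext=> k; rewrite /gmul /gdelta.
  rewrite -[k in RHS](rpushK (linv a)) linvK (inj_eq (can_inj (rpushK a))).
  by case: eqP => // _; rewrite nmul0r.
exists phi; split=> // [al A be l|].
- elim: al => [|e al IH]; last first.
    by rewrite /= phiM lend_mulE IH phiS /= (mulE (true, e)) nmulA.
  rewrite /pairword /=; elim: be (rnil _) l => [|e be IH] w l /=.
    rewrite phiP /=; apply/funext=> k; rewrite /gmul /gdelta.
    by case: eqP => // _; rewrite nmul0r.
  by rewrite phiM lend_mulE phiSs /= (mulE (false, e)) IH nmulA.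
elim=> [|e ga IH] A f k; first by rewrite phiP.
have -> : monomial R (e :: ga) A (e :: ga)
          = lS R e ** (monomial R ga A ga ** lSs R e).
  by apply: unit_inj_inj; rewrite !(unit_injM, monomialE) /= !mulrA.
rewrite !phiM phiS phiSs !lend_mulE /= {1}/gmul IH /gmul.
by rewrite (rpushK (false, e)) !nmulA.
Qed.

Definition mono_degree (m : mono G) : I := pairword m.1.1 m.2.

Definition component (w : I) (s : seq (R * mono G)) : seq (R * mono G) :=
  [seq i <- s | mono_degree i.2 == w].

(** Applying both sides of the hypothesis to $\delta_1 \otimes l$ and reading
    the value at [w] isolates the terms of degree [w]; this replaces the proof
    that the sum of the homogeneous parts is direct. *)
Lemma component_commute (s : seq (R * mono G)) ga A w :
  monosum s ** monomial R ga A ga = monomial R ga A ga ** monosum s ->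
  monosum (component w s) ** monomial R ga A ga
  = monomial R ga A ga ** monosum (component w s).
Proof.
move=> sc; have [phi [[phiD phiZ phiM] phi_mono phi_diag]] := graded_rep.
have phi0 : phi 0 = 0 by apply: (addrI (phi 0)); rewrite -phiD !addr0.
set c := monomial R ga A ga in sc *; set y := monosum (component w s).
have phi_s l : phi (monosum s) (gdelta (rnil _) l) w = y ** l.
  rewrite /y /component /monosum {y sc}.
  elim: s => [|[a [[al B] be]] s IH].
    by rewrite !big_nil phi0 nmul0l.
  rewrite big_cons phiD phiZ lend_addE lend_scaleE -[LHS]/(_ + _) IH /=.
  rewrite -[X in X + _]/(a *: (_ : L)) phi_mono /gdelta /mono_degree /= eq_sym.
  case: eqP => _; last by rewrite scaler0 add0r.
  by rewrite big_cons nmulDl nscaleAl.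
have [B] := right_local_unit (y ** c - c ** y).
suff -> : (y ** c - c ** y) ** lP R B = 0 by move=> /esym/eqP; rewrite subr_eq0 => /eqP.
have := congr1 (fun z => phi z (gdelta (rnil _) (lP R B)) w) sc.
rewrite !phiM !lend_mulE phi_diag phi_s phi_mono pairword_diag phi_s.
by rewrite -/c nmulDl -scaleN1r -nscaleAl -!nmulA => ->; rewrite scaleN1r subrr.
Qed.

Lemma monosum_components (s : seq (R * mono G)) : exists D : seq I,
  monosum s = \sum_(w <- D) monosum (component w s).
Proof.
exists (undup [seq mono_degree i.2 | i <- s]).
(* the sum can be taken over any duplicate-free list containing all degrees *)
have [] : uniq (undup [seq mono_degree i.2 | i <- s]) /\
    {subset [seq mono_degree i.2 | i <- s]
       <= undup [seq mono_degree i.2 | i <- s]}.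
  by split=> [|w]; rewrite ?undup_uniq ?mem_undup.
move: (undup _) => D uD; elim: s => [|i s IH] sD.
  by rewrite big1 /monosum ?big_nil // => w _; rewrite big_nil.
rewrite /monosum big_cons -!/(monosum _) IH; last first.
  by move=> w ws; apply: sD; rewrite inE ws orbT.
rewrite (bigD1_seq (mono_degree i.2)) //=; last by apply: sD; rewrite inE eqxx.
rewrite [RHS](bigD1_seq (mono_degree i.2)) //=; last by apply: sD; rewrite inE eqxx.
rewrite addrA eqxx; congr (_ + _); first by rewrite /monosum big_cons.
by apply: eq_bigr => w; rewrite eq_sym => /negbTE->.
Qed.

End Grading.

(** * Loops without exits and their corners *)

Section NonBranching.
Variable G : ultragraph.

Definition single_successor (S : set (vertex G)) (u : vertex G) : Prop :=
  exists e w, [/\ forall f, src f = u <-> f = e, rng e = [set w] & S w].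

(** Every vertex reachable from $v$ emits exactly one edge, whose range is a
    single vertex: $v$ is the source of exactly one infinite path. *)
Definition nonbranching (v : vertex G) : Prop :=
  exists S : set (vertex G), S v /\ forall u, S u -> single_successor S u.

(** The absence of exits forces $r(\lambda_i) = \{s(\lambda_{i+1})\}$, indices
    modulo the length, and that $s(\lambda_i)$ emits only $\lambda_i$. So the
    sources of the edges of $\lambda$ form a closed set of vertices with
    single successors. *)
Lemma loop_without_exits_nonbranching e (la : seq (edge G)) :
    loop_without_exits (e :: la) ->
  nonbranching (src e) /\ rng (last e la) = [set src e].
Proof.
set l := e :: la; move=> [[ul el] nexit].
pose n := size l; have n0 : (0 < n)%N by [].
have nxt i : (i < n)%N ->
    rng (nth e l i) = [set src (nth e l (i.+1 %% n))].
  move=> lin; have into w : rng (nth e l i) w -> w = src (nth e l (i.+1 %% n)).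
    move=> iw; have : ~ sink w.
      by move=> sw; apply: nexit; right; exists (nth e l i), w; rewrite mem_nth.
    move=> /existsNP[f /contrapT fw]; rewrite -fw; congr src.
    apply: contrapT => fn; apply: nexit; left; exists i, f; split=> //.
      by rewrite (set_nth_default e) // fw.
    by rewrite (set_nth_default e) // ltn_pmod.
  apply/seteqP; split=> [w /into -> //|_ ->].
  by have [w iw] := rng_neq0 (nth e l i); rewrite -(into w iw).
have prv j : (j < n)%N -> exists2 i, (i < n)%N & j = (i.+1 %% n)%N.
  case: j => [|j] ljn; last by exists j; [exact: ltnW|rewrite modn_small].
  by exists n.-1; rewrite prednK // modnn.
split; last by have := nxt n.-1; rewrite prednK // modnn nth_last; apply.
exists [set u | exists2 j, (j < n)%N & u = src (nth e l j)].
split; first by exists 0%N.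
move=> _ [j ljn ->]; exists (nth e l j), (src (nth e l (j.+1 %% n))); split.
- move=> f; split=> [fj|-> //]; have [i lin ij] := prv j ljn.
  apply: contrapT => fn; apply: nexit; left; exists i, f; split=> //.
    by rewrite (set_nth_default e) // (nxt i lin) /= fj ij.
  by rewrite -/n -ij (set_nth_default e).
- exact: nxt.
- by exists (j.+1 %% n)%N; rewrite ?ltn_pmod.
Qed.

End NonBranching.

Section Corner.
Variables (R : comNzRingType) (G : ultragraph).
Local Notation L := (leavitt R G).
Local Notation U := (unitization L).
Local Notation iota := (@unit_inj R L).
Local Notation p v := (uP R (gset1 v)).

Section Track.
Variables (S : set (vertex G)) (E : vertex G -> edge G) (N : vertex G -> vertex G).
Hypothesis EP : forall u, S u -> forall f, src f = u <-> f = E u.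
Hypothesis NP : forall u, S u -> rng (E u) = [set N u].
Hypothesis SN : forall u, S u -> S (N u).

(** $s_\tau$ and $s_\tau^*$ for the only path $\tau$ of length $n$ starting
    at $u$; [E u] is its first edge and [N u] the vertex that it leads to. *)
Fixpoint track n u : U :=
  if n is m.+1 then us R (E u) * track m (N u) else p u.
Fixpoint cotrack n u : U :=
  if n is m.+1 then cotrack m (N u) * ut R (E u) else p u.

Lemma srcE u : S u -> src (E u) = u.
Proof. by move=> Su; apply/(EP Su). Qed.

Lemma S_iter n u : S u -> S (iter n N u).
Proof. by move=> Su; elim: n => //= n; apply: SN. Qed.

Lemma p_rngE u : S u -> uP R (gset_rng (E u)) = p (N u).
Proof. by move=> Su; congr uP; apply: gset_inj; rewrite /= NP. Qed.

Lemma p_track n u : S u -> p u * track n u = track n u.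
Proof.
case: n => [|n] Su /=; first exact: uPP.
by rewrite mulrA uPs_in //= srcE.
Qed.

Lemma cotrack_p n u : S u -> cotrack n u * p u = cotrack n u.
Proof.
case: n => [|n] Su /=; first exact: uPP.
by rewrite -mulrA utP_in //= srcE.
Qed.

Lemma track_p n u : track n u * p (iter n N u) = track n u.
Proof.
elim: n u => [|n IH] u; first exact: uPP.
by rewrite iterSr /= -mulrA IH.
Qed.

Lemma p_cotrack n u : p (iter n N u) * cotrack n u = cotrack n u.
Proof.
elim: n u => [|n IH] u; first exact: uPP.
by rewrite iterSr /= mulrA IH.
Qed.

Lemma track_add m n u : S u -> track (m + n) u = track m u * track n (iter m N u).
Proof.
elim: m u => [|m IH] u Su; first by rewrite p_track.
by rewrite addSn iterSr /= IH ?mulrA //; exact: SN.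
Qed.

Lemma cotrack_add m n u : S u ->
  cotrack (m + n) u = cotrack n (iter m N u) * cotrack m u.
Proof.
elim: m u => [|m IH] u Su; first by rewrite cotrack_p.
by rewrite addSn iterSr /= IH ?mulrA //; exact: SN.
Qed.

(** At a vertex emitting just one edge the Cuntz-Krieger relation reads
    $p_u = s_e s_e^*$. *)
Lemma track_cotrack n u : S u -> track n u * cotrack n u = p u.
Proof.
elim: n u => [|n IH] u Su; first exact: uPP.
rewrite /= mulrA -(mulrA _ (track _ _)) IH; last exact: SN.
by rewrite -p_rngE // us_rng -(uP_CK R (EP Su)).
Qed.

Lemma cotrack_track n u : S u -> cotrack n u * track n u = p (iter n N u).
Proof.
elim: n u => [|n IH] u Su; first exact: uPP.
rewrite /= -mulrA (mulrA (ut R _)) ut_us eqxx p_rngE // p_track; last exact: SN.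
by rewrite IH -?iterSr //; exact: SN.
Qed.

Lemma p_uS u al : S u ->
  p u * uS R al = 0 \/ p u * uS R al = track (size al) u.
Proof.
elim: al u => [|e al IH] u Su; first by right; rewrite mulr1.
case: (eqVneq (src e) u) => [/(EP Su)->|/eqP eu]; last by left; rewrite uPS_out.
rewrite uPS_in /= ?srcE // -us_rng -mulrA p_rngE //.
by case: (IH _ (SN Su)) => ->; [left; rewrite mulr0|right; rewrite -mulrA p_track //; exact: SN].
Qed.

Lemma uT_p u al : S u ->
  uT R al * p u = 0 \/ uT R al * p u = cotrack (size al) u.
Proof.
elim: al u => [|e al IH] u Su; first by right; rewrite mul1r.
case: (eqVneq (src e) u) => [/(EP Su)->|/eqP eu]; last by left; rewrite uTP_out.
rewrite uTP_in /= ?srcE // -uP_rng mulrA p_rngE //.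
by case: (IH _ (SN Su)) => ->; [left; rewrite mul0r|right; rewrite mulrA cotrack_p //; exact: SN].
Qed.

(** What remains of a monomial after cutting it down to $p_v L p_v$: it goes
    forward along the only infinite path from $v$ and comes back. *)
Definition shuttle v (z : U) : Prop :=
  z = 0 \/ exists m n, iter m N v = iter n N v /\ z = track m v * cotrack n v.

Lemma shuttle_monomial v al A be : S v ->
  shuttle v (p v * iota (monomial R al A be) * p v).
Proof.
move=> Sv; rewrite monomialE !mulrA -[_ * _ * p v]mulrA.
case: (p_uS al Sv) => ->; first by left; rewrite !mul0r.
case: (uT_p be Sv) => ->; first by left; rewrite mulr0.
set m := size al; set n := size be.
rewrite -track_p -(p_cotrack n) -!mulrA (mulrA (uP R A)) (mulrA (p _)) !uPI.
case: (pselect (sval A (iter m N v) /\ iter m N v = iter n N v)) => [[Am mn]|nA].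
  right; exists m, n; split=> //; rewrite -mn gsetI_in //.
  rewrite [gsetI _ _](_ : _ = gset1 (iter m N v)) ?mulrA ?track_p //.
  by apply: gset_inj; rewrite /= setIid.
left; rewrite [gsetI _ _](_ : _ = gset0 G) ?uP0 ?mul0r ?mulr0 //.
by apply/gset_inj/seteqP; split=> // w /= [-> [Am mn]]; apply: nA; rewrite -mn.
Qed.

(** Both factors can be extended until the inner parts have the same length and
    cancel. The result is symmetric in the pairs $(m, n)$ and $(k, l)$. *)
Lemma shuttleM m n k l v : S v ->
    iter m N v = iter n N v -> iter k N v = iter l N v ->
  track m v * cotrack n v * (track k v * cotrack l v)
  = track (m + k) v * cotrack (n + l) v.
Proof.
move=> Sv mn kl.
have extend i j h : iter i N v = iter j N v ->
    track i v * cotrack j v = track (i + h) v * cotrack (j + h) v.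
  move=> ij; rewrite track_add // cotrack_add // -ij -!mulrA (mulrA (track h _)).
  rewrite track_cotrack; last exact: S_iter.
  by rewrite mulrA track_p.
rewrite (extend m n k) // (extend k l n) // [(k + n)%N]addnC -!mulrA.
rewrite (mulrA (cotrack (n + k) v)) cotrack_track //.
have -> : iter (n + k) N v = iter (m + k) N v by rewrite addnC iterD -mn -iterD addnC.
by rewrite mulrA track_p [(l + n)%N]addnC.
Qed.

Lemma shuttle_comm v z z' : S v -> shuttle v z -> shuttle v z' -> z * z' = z' * z.
Proof.
move=> Sv [->|[m [n [mn ->]]]]; first by rewrite mul0r mulr0.
move=> [->|[k [l [kl ->]]]]; first by rewrite mul0r mulr0.
by rewrite !shuttleM // addnC [in RHS]addnC; congr (_ * _); rewrite addnC.
Qed.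

End Track.

(** Monomials cut down to the corner are shuttles, and by bilinearity it is
    enough to commute two of these. *)
Lemma nonbranching_corner v (x y : L) : nonbranching v ->
  (p v * iota x * p v) * (p v * iota y * p v)
  = (p v * iota y * p v) * (p v * iota x * p v).
Proof.
move=> [S [Sv SP]]; have [e0 [_ _]] := SP v Sv.
have /choice[EN ENP] : forall u, exists ew : edge G * vertex G, S u ->
    [/\ forall f, src f = u <-> f = ew.1, rng ew.1 = [set ew.2] & S ew.2].
  move=> u; case: (pselect (S u)) => [/SP[e [w h]]|nu]; first by exists (e, w).
  by exists (e0, v) => /nu.
have EP u : S u -> forall f, src f = u <-> f = (EN u).1 by move=> /ENP[].
have NP u : S u -> rng (EN u).1 = [set (EN u).2] by move=> /ENP[].
have SN u : S u -> S (EN u).2 by move=> /ENP[].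
have comm0 := fun z z' => @shuttle_comm S _ _ EP NP SN v z z' Sv.
have mono0 := fun al A be => @shuttle_monomial S _ _ EP NP SN v al A be Sv.
have sumE (s : seq (R * mono G)) : p v * iota (monosum s) * p v
    = \sum_(i <- s) i.1 *: (p v * iota (lmono R i.2) * p v).
  rewrite /monosum; elim/big_rec2: _ => [|i a b _ <-]; first by rewrite mulr0 mul0r.
  by rewrite unit_injD unit_injZ mulrDr mulrDl -scalerAr -scalerAl.
have [s ->] := monospanT x; have [s' ->] := monospanT y; rewrite !sumE.
rewrite mulr_suml mulr_sumr; apply: eq_bigr => i _.
rewrite mulr_sumr mulr_suml; apply: eq_bigr => j _.
rewrite -scalerAl -!scalerAr -scalerAl !scalerA mulrC; congr (_ *: _).
by apply: comm0; exact: mono0.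
Qed.

End Corner.

(** * Commutativity of the core *)

Section CoreCommutative.
Variables (R : comNzRingType) (G : ultragraph).
Local Notation L := (leavitt R G).
Local Notation U := (unitization L).
Local Notation iota := (@unit_inj R L).
Local Notation p v := (uP R (gset1 v)).

Implicit Types (e : edge G) (v : vertex G) (A : gset G).
Implicit Types (be ga ep : seq (edge G)) (q z w : U).

Definition conj_word (be : seq (edge G)) (z : U) : U := uS R be * z * uT R be.

(** Every generator of the core has the form $s_\beta z s_\beta^*$ with $z$ of
    this kind. *)
Definition local_kernel (z : U) : Prop :=
  (exists A, z = uP R A) \/
  (exists v (x : L), nonbranching v /\ z = p v * iota x * p v).

Lemma uP_p A v : uP R A * p v = 0 \/ uP R A * p v = p v.
Proof.
rewrite uPI; case: (pselect (sval A v)) => Av.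
  by right; rewrite gsetI_in.
by left; rewrite gsetI_out // uP0.
Qed.

Lemma vertexlike_kernel q z : vertexlike q -> local_kernel z -> q * z = z * q.
Proof.
case=> [->|[->|[A ->]]]; rewrite ?mul0r ?mulr0 ?mul1r ?mulr1 // => -[[B ->]|].
  exact: uPC.
move=> [v [x [_ ->]]]; rewrite !mulrA -[RHS]mulrA -[p v * uP R A]uPC.
by case: (uP_p A v) => ->; rewrite ?mul0r ?mulr0.
Qed.

Lemma vertexlike_conj q ep z : vertexlike q -> local_kernel z ->
  q * conj_word ep z = conj_word ep z * q.
Proof.
rewrite /conj_word; case: ep => [|e ep] qv zk.
  by rewrite /= mul1r mulr1 vertexlike_kernel.
case: qv => [->|[->|[A ->]]]; rewrite ?mul0r ?mulr0 ?mul1r ?mulr1 //.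
rewrite [LHS]mulrA [X in X * _ = _]mulrA -[RHS]mulrA.
case: (pselect (sval A (src e))) => Ae.
  by rewrite (uPS_in R ep Ae) (uTP_in R ep Ae).
by rewrite (uPS_out R ep Ae) (uTP_out R ep Ae) !mul0r mulr0.
Qed.

Definition in_algebra (z : U) : Prop := exists x : L, z = iota x.

Lemma in_algebra_conj be z : in_algebra z -> in_algebra (conj_word be z).
Proof.
rewrite /conj_word; elim: be => [|e be IH]; first by rewrite mul1r mulr1.
move=> /IH[x xE]; exists (lS R e ** x ** lSs R e).
by rewrite !unit_injM -xE /= !mulrA.
Qed.

Lemma local_kernel_in_algebra z : local_kernel z -> in_algebra z.
Proof.
case=> [[A ->]|[v [x [_ ->]]]]; first by exists (lP R A).
by exists (lP R (gset1 v) ** x ** lP R (gset1 v)); rewrite !unit_injM.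
Qed.

(** If $z \in p_v L p_v$ and $u$ commutes with $p_v$, then only the part
    $p_v u p_v$ of $u$ meets $z$, and the corner is commutative. *)
Lemma kernel_conj_comm z ep w : local_kernel z -> local_kernel w ->
  z * conj_word ep w = conj_word ep w * z.
Proof.
move=> [[A ->]|[v [x [nv ->]]]] wk.
  exact: vertexlike_conj (vertexlikeP _ _) wk.
have pu := vertexlike_conj ep (vertexlikeP R (gset1 v)) wk.
have [y yE] := in_algebra_conj ep (local_kernel_in_algebra wk).
set u := conj_word ep w in pu yE *.
have cut : p v * u * p v = p v * u by rewrite -mulrA -pu mulrA uPP.
have -> : p v * iota x * p v * u = p v * iota x * p v * (p v * iota y * p v).
  by rewrite -yE cut !mulrA -(mulrA _ (p v) (p v)) uPP.
rewrite nonbranching_corner // -yE cut pu !mulrA.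
by rewrite -(mulrA u (p v) (p v)) uPP.
Qed.

(** If one of the words is a prefix of the other, the common prefix can be
    pulled out of both elements and [kernel_conj_comm] applies; otherwise both
    products are $0$. *)
Lemma conj_word_comm be ga z w : local_kernel z -> local_kernel w ->
  conj_word be z * conj_word ga w = conj_word ga w * conj_word be z.
Proof.
have prefix_case be' ep (z' w' : U) : local_kernel z' -> local_kernel w' ->
    conj_word be' z' * conj_word (be' ++ ep) w'
    = conj_word (be' ++ ep) w' * conj_word be' z'.
  move=> zk wk; have qv := vertexlikeQ R be'.
  have qu := vertexlike_conj ep qv wk; have zu := kernel_conj_comm ep zk wk.
  have -> : conj_word (be' ++ ep) w' = uS R be' * conj_word ep w' * uT R be'.
    by rewrite /conj_word uS_cat uT_cat !mulrA.
  move: (conj_word ep w') qu zu => u qu zu.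
  rewrite /conj_word !mulrA -!(mulrA _ (uT R be') (uS R be')) uTS.
  congr (_ * _); rewrite -!mulrA; congr (_ * _).
  by rewrite qu mulrA zu -mulrA -(vertexlike_kernel qv zk).
move=> zk wk; case: (boolP (prefix be ga)) => [/prefixP[ep ->]|nbg].
  exact: prefix_case.
case: (boolP (prefix ga be)) => [/prefixP[ep ->]|ngb].
  by rewrite prefix_case.
rewrite /conj_word !mulrA -!(mulrA _ (uT R _) (uS R _)).
by rewrite !uTS_incomparable // !mulr0 !mul0r.
Qed.

Definition core_generator (x : L) : Prop :=
  exists al A be,
    [/\ admissible al A be,
        [\/ al = be,
            exists2 la, loop_without_exits la & al = be ++ la |
            exists2 la, loop_without_exits la & be = al ++ la] &
        x = monomial R al A be].

Lemma core_generatorP x : core_generator x ->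
  exists be z, local_kernel z /\ iota x = conj_word be z.
Proof.
have loop_kernel la A : loop_without_exits la ->
    local_kernel (uS R la * uP R A) /\ local_kernel (uP R A * uT R la).
  case: la => [[]//|e la] lam.
  have [nv lv] := loop_without_exits_nonbranching lam.
  have Pv : uP R (gset_rng (last e la)) = p (src e).
    by congr uP; apply: gset_inj.
  have Sv : p (src e) * uS R (e :: la) * p (src e) = uS R (e :: la).
    by rewrite uPS_in // -Pv uS_last.
  have Tv : p (src e) * uT R (e :: la) * p (src e) = uT R (e :: la).
    by rewrite -mulrA uTP_in // -Pv uT_last.
  split; right; exists (src e).
    exists (monomial R (e :: la) A [::]); split=> //.
    rewrite monomialE mulr1; move: (uS R (e :: la)) Sv => s Sv.
    by rewrite -{1}Sv -!mulrA (uPC R A).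
  exists (monomial R [::] A (e :: la)); split=> //.
  rewrite monomialE mul1r; move: (uT R (e :: la)) Tv => t Tv.
  by rewrite -{1}Tv !mulrA (uPC R A).
move=> [al [A [be [_ h ->]]]]; rewrite monomialE; case: h => [->|[la lam ->]|[la lam ->]].
- by exists be, (uP R A); split=> //; left; exists A.
- exists be, (uS R la * uP R A); split; first by case: (loop_kernel la A lam).
  by rewrite /conj_word uS_cat !mulrA.
- exists al, (uP R A * uT R la); split; first by case: (loop_kernel la A lam).
  by rewrite /conj_word uT_cat !mulrA.
Qed.

Lemma core_commutative : commutative_set (core_algebra R G).
Proof.
apply: gen_subalgebra_commutative => x y.
move=> /core_generatorP[be [z [zk xE]]] /core_generatorP[ga [w [wk yE]]].
by apply: unit_inj_inj; rewrite !unit_injM xE yE conj_word_comm.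
Qed.

Lemma diagonal_sub_core : diagonal_algebra R G `<=` core_algebra R G.
Proof.
apply: sub_smallest2r; first exact: gen_subalgebraP.
by move=> x [al [A [ad ->]]]; exists al, A, al; split=> //; constructor.
Qed.

Lemma core_sub_centraliser :
  core_algebra R G `<=` centraliser (diagonal_algebra R G).
Proof. by move=> x cx y /diagonal_sub_core; apply: core_commutative. Qed.

Lemma diagonal_monomial ga A : diagonal_algebra R G (monomial R ga A ga).
Proof.
have [D0 _ _ _] := gen_subalgebraP
  [set x : L | exists al A, admissible al A al /\ x = monomial R al A al].
case: (pselect (monomial R ga A ga = 0)) => [->//|/monomial_neq0_admissible ad].
by apply: sub_gen_smallest; exists ga, A.
Qed.

End CoreCommutative.

(** * The centraliser of the diagonal *)

Section CentraliserOfDiagonal.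
Variables (R : comNzRingType) (G : ultragraph).
Local Notation L := (leavitt R G).
Local Notation U := (unitization L).
Local Notation iota := (@unit_inj R L).
Local Notation p v := (uP R (gset1 v)).
Local Notation S al := (uS R al).
Local Notation T al := (uT R al).
Local Notation Q al := (uQ R al).

Implicit Types (e : edge G) (v : vertex G) (A : gset G).
Implicit Types (al be ga de la mu nu : seq (edge G)) (q z w : U) (x y d : L).

(** For $\alpha$ and $\beta$ without common last letter this is the homogeneous
    part of degree $\alpha\beta^{-1}$. [spread [::] [::]] is the linear span of
    the diagonal monomials. *)
Inductive spread al be : L -> Prop :=
| spread0 : spread al be 0
| spread_add (a : R) ga A y : spread al be y ->
    spread al be (a *: monomial R (al ++ ga) A (be ++ ga) + y).

Local Notation dspan := (spread [::] [::]).

Lemma spread_factor al be y : spread al be y ->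
  exists2 d, dspan d & iota y = S al * iota d * T be.
Proof.
elim=> [|a ga A {}y _ [d dd yE]].
  by exists 0; [exact: spread0|rewrite unit_inj0 mulr0 mul0r].
exists (a *: monomial R ga A ga + d); first exact: spread_add.
rewrite !unit_injD !unit_injZ yE !monomialE uS_cat uT_cat mulrDr mulrDl.
by rewrite -scalerAr -scalerAl !mulrA.
Qed.

Lemma component_spread (w : rword (edge G)) (s : seq (R * mono G)) :
  spread (pos_part w) (neg_part w) (monosum (component w s)).
Proof.
rewrite /monosum /component; elim: s => [|[a [[al A] be]] s IH] /=.
  by rewrite big_nil; exact: spread0.
case: eqP => // wE; rewrite big_cons /lmono /mono_degree /= in IH wE *.
rewrite -wE in IH *.
have [ga [alE beE]] := pairword_split al be.
rewrite [X in monomial R X _ _]alE [X in monomial R _ _ X]beE; exact: spread_add.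
Qed.

Lemma core_subalgebra : subalgebra (core_algebra R G).
Proof. exact: gen_subalgebraP. Qed.

Lemma spread_diag_core al y : spread al al y -> core_algebra R G y.
Proof.
have [c0 cD cZ _] := core_subalgebra.
elim=> // a ga A {}y _ cy; apply: cD => //; apply: cZ.
by apply: diagonal_sub_core; exact: diagonal_monomial.
Qed.

Lemma dspan_comm d ga A : dspan d ->
  iota d * (S ga * uP R A * T ga) = S ga * uP R A * T ga * iota d.
Proof.
elim=> [|a de B y _ IH]; first by rewrite mulr0 mul0r.
rewrite unit_injD unit_injZ mulrDl mulrDr -scalerAl -scalerAr IH monomialE.
by congr (_ *: _ + _); apply: conj_word_comm; left; eexists.
Qed.

Lemma dspan_mulr d q : dspan d -> vertexlike q ->
  exists2 d', dspan d' & iota d' = iota d * q.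
Proof.
move=> dd [->|[->|[B ->]]].
- by exists 0; rewrite ?mulr0 //; exact: spread0.
- by exists d; rewrite ?mulr1.
elim: dd => [|a de A y _ [d' dd' IH]].
  by exists 0; rewrite ?mul0r //; exact: spread0.
rewrite unit_injD mulrDl -IH unit_injZ -scalerAl monomialE [_ ++ de]/=.
case: de => [|e de].
  exists (a *: monomial R [::] (gsetI A B) [::] + d'); first exact: spread_add.
  by rewrite unit_injD unit_injZ monomialE !mulr1 !mul1r uPI.
case: (pselect (sval B (src e))) => Be.
  exists (a *: monomial R (e :: de) A (e :: de) + d').
    exact: (@spread_add [::] [::] a (e :: de) A d').
  by rewrite unit_injD unit_injZ monomialE -(mulrA _ _ (uP R B)) (uTP_in R de Be).
exists d' => //.
by rewrite -(mulrA _ _ (uP R B)) (uTP_out R de Be) mulr0 scaler0 add0r.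
Qed.

(** A long enough path refines the finitely many cylinders involved in an
    element of the diagonal, hence sees only one coefficient of it. *)
Lemma dspan_cylinder d : dspan d -> exists K, forall de, (K < size de)%N ->
  exists r : R, iota d * (S de * T de) = r *: (S de * T de).
Proof.
elim=> [|a ga A y _ [K KP]].
  by exists 0%N => de _; exists 0; rewrite mul0r scale0r.
exists (maxn K (size ga)) => de; rewrite gtn_max => /andP[/KP[r rE] gade].
rewrite [_ ++ ga]/= unit_injD mulrDl rE unit_injZ -scalerAl monomialE.
have [b ->] : exists b : R, S ga * uP R A * T ga * (S de * T de) = b *: (S de * T de).
  case: (boolP (prefix ga de)) => [/prefixP[ep deE]|ngd]; last first.
    exists 0; rewrite scale0r mulrA -(mulrA _ (T ga)) uTS_incomparable ?mulr0 ?mul0r //.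
    by apply/negP => /size_prefix; rewrite leqNgt gade.
  rewrite {1}deE uS_cat !mulrA -(mulrA _ (T ga) (S ga)) uTS.
  rewrite -(mulrA (S ga)) -(vertexlike_kernel (vertexlikeQ R ga)); last by left; eexists.
  rewrite mulrA uSQ -(mulrA _ (uP R A)).
  case: ep deE => [|e ep] deE; first by move: gade; rewrite deE cats0 ltnn.
  case: (pselect (sval A (src e))) => Ae.
    by exists 1; rewrite (uPS_in R ep Ae) -uS_cat -deE scale1r.
  by exists 0; rewrite (uPS_out R ep Ae) mulr0 mul0r scale0r.
by exists (a * b + r); rewrite scalerA scalerDl.
Qed.

Definition wpow la k : seq (edge G) := flatten (nseq k la).

Lemma wpowS la k : wpow la k.+1 = la ++ wpow la k. Proof. by []. Qed.

Lemma wpowD la j k : wpow la (j + k) = wpow la j ++ wpow la k.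
Proof. by elim: j => //= j IH; rewrite -[RHS]catA -IH. Qed.

Lemma wpow_size la k : la <> [::] -> (k <= size (wpow la k))%N.
Proof.
move=> la0; elim: k => // k IH; rewrite wpowS size_cat.
by case: la la0 IH => //= e la _ IH; rewrite addSn ltnS (leq_trans IH) ?leq_addl.
Qed.

(** The projection $s_\alpha s_\alpha^*$ on the paths that start with
    $\alpha$ *)
Definition cyl al : U := S al * T al.

Lemma cylE al : al <> [::] -> exists A, cyl al = S al * uP R A * T al \/ cyl al = 0.
Proof.
case: al => // e al _; exists (gset_rng (last e al)).
have -> : cyl (e :: al) = S (e :: al) * Q (e :: al) * T (e :: al) by rewrite uSQ.
by rewrite /uQ; case: ifP => _; [left|right; rewrite mulr0 mul0r].
Qed.

Lemma cyl_comm z : (forall ga A, z * (S ga * uP R A * T ga) = S ga * uP R A * T ga * z) ->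
  forall al, z * cyl al = cyl al * z.
Proof.
move=> zC [|e al]; first by rewrite /cyl !mulr1 mul1r.
have [//|A [->|->]] := @cylE (e :: al); first exact: zC.
by rewrite mul0r mulr0.
Qed.

Lemma cyl_cat al be : cyl (al ++ be) = S al * cyl be * T al.
Proof. by rewrite /cyl uS_cat uT_cat !mulrA. Qed.

Lemma cyl_cat_conj al be : T al * cyl (al ++ be) * S al = Q al * cyl be * Q al.
Proof. by rewrite cyl_cat !mulrA uTS -!mulrA uTS. Qed.

Lemma cyl_mul_cat al be : cyl al * cyl (al ++ be) = cyl (al ++ be).
Proof.
rewrite cyl_cat /cyl !mulrA -(mulrA (S al)) uTS.
by rewrite uSQ.
Qed.

Lemma uQ_cyl_comm al be : Q al * cyl be = cyl be * Q al.
Proof.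
case: be => [|e be]; first by rewrite /cyl !mulr1 mul1r.
have [//|A [->|->]] := @cylE (e :: be); last by rewrite mul0r mulr0.
by apply: vertexlike_conj; [exact: vertexlikeQ|left; eexists].
Qed.

(** If $r s_{\lambda^k}s_{\lambda^k}^* = r p_{r(\lambda)}$ then an exit would
    be a nonzero part of $p_{r(\lambda_i)}$ missed by the cylinder. *)
Lemma fixed_loop_has_no_exit (r : R) e la k :
    r <> 0 -> upath (e :: la) -> rng (last e la) (src e) ->
    r *: uP R (gset_rng (last e la)) = r *: cyl (wpow (e :: la) k.+2) ->
  ~ has_exit (e :: la).
Proof.
set l := e :: la => r0 ul le rE.
pose n := size l.
(* conjugating [rE] by the first i + 1 edges moves it from the range of the loop
   to the range of its edge i, where an exit can be tested *)
have step i : (i < n)%N -> exists nu,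
    r *: uP R (gset_rng (nth e l i))
    = r *: (uP R (gset_rng (nth e l i)) * cyl (nth e l (i.+1 %% n) :: nu)
            * uP R (gset_rng (nth e l i))).
  move=> lin; pose mu := take i.+1 l.
  pose nu := drop i.+1 l ++ wpow l k.+1.
  have muE : mu = e :: take i la by [].
  have muln : wpow l k.+2 = mu ++ nu by rewrite /nu catA cat_take_drop wpowS.
  have umu : upath mu by rewrite /upath /mu take_sorted.
  have Qmu : Q mu = uP R (gset_rng (nth e l i)).
    rewrite muE /uQ -muE umu; congr (uP R (gset_rng _)).
    rewrite -[RHS](@nth_take i.+1) // -/mu muE (last_nth e) /=.
    by rewrite size_takel.
  have Pmu : uP R (gset_rng (last e la)) * S mu = S mu.
    by rewrite muE uPS_in.
  exists (behead nu).
  have -> : nth e l (i.+1 %% n) :: behead nu = nu.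
    move: lin; rewrite leq_eqVlt => /predU1P[in_|lin].
      by rewrite /nu in_ modnn drop_size wpowS.
    by rewrite modn_small // /nu (drop_nth e).
  have := congr1 (fun z => T mu * z * S mu) rE.
  rewrite -!scalerAr -!scalerAl -(mulrA _ (uP R _)) Pmu uTS Qmu => ->.
  by rewrite muln cyl_cat_conj Qmu.
case=> [[i [f [lin fi fn]]]|[a [w [la_ sw aw]]]].
  rewrite (set_nth_default e) // in fi; rewrite (set_nth_default e) ?ltn_pmod // in fn.
  have [nu nuE] := step i lin.
  have := congr1 (fun z => ut R f * z * us R f) nuE.
  rewrite -!scalerAr -!scalerAl !mulrA utP_in // ut_us eqxx.
  rewrite ut_us.
  case: eqP => // _; rewrite !mul0r scaler0 => r1.
  apply: r0; apply: (scale_lP_eq0 (rng_neq0 f : sval (gset_rng f) !=set0)).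
  by apply: unit_inj_inj; rewrite unit_injZ.
have ail : (index a l < n)%N by rewrite index_mem.
have [nu nuE] := step _ ail.
rewrite nth_index // in nuE.
have := congr1 (fun z => p w * z * p w) nuE.
rewrite -!scalerAr -!scalerAl !mulrA.
have -> : p w * uP R (gset_rng a) = p w by rewrite uPC uPI gsetI_in.
rewrite uPs_out; last exact: sw.
rewrite !mul0r scaler0 uPP => r1; apply: r0; apply: (@scale_lP1_eq0 R G r w).
by apply: unit_inj_inj; rewrite unit_injZ.
Qed.

(** With $z = s_\beta^* y s_\beta = s_\lambda d'$ commuting with the diagonal,
    commutation with the cylinders of $\lambda^k$ gives
    $d' = d' s_{\lambda^k} s_{\lambda^k}^*$ for all $k$. As $d'$ involves
    finitely many cylinders, it is then a multiple of a single one, hence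
    $d' = r p_{r(\lambda)}$, and $\lambda$ has no exit unless $d' = 0$. *)
Lemma loop_component y d be la : la <> [::] -> dspan d ->
    iota y = S be * S la * iota d * T be ->
    (forall ga A, y ** monomial R ga A ga = monomial R ga A ga ** y) ->
  core_algebra R G y.
Proof.
move=> la0 dd yE yC; have [core0 _ coreZ _] := core_subalgebra.
have core_z : iota y = 0 -> core_algebra R G y.
  by rewrite -unit_inj0 => /unit_inj_inj->.
pose z := T be * iota y * S be.
have zE : z = Q be * S la * iota d * Q be.
  by rewrite /z yE !mulrA uTS -!mulrA uTS.
have Qz : Q be * z = z by rewrite zE !mulrA uQQ.
have zQ : z * Q be = z by rewrite zE -!mulrA uQQ.
have y_z : iota y = S be * z * T be.
  by rewrite zE !mulrA uSQ -!mulrA uQT !mulrA yE.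
have [] : Q be * S la = 0 \/ Q be * S la = S la.
  by case: la la0 {zE yE} => // e la _; exact/vertexlike_S/vertexlikeQ.
  by move=> E; apply: core_z; rewrite y_z zE E !mul0r mulr0 mul0r.
move=> QS; rewrite QS in zE.
have zC ga A : z * (S ga * uP R A * T ga) = S ga * uP R A * T ga * z.
  set c := S ga * uP R A * T ga.
  have Qc : Q be * c = c * Q be.
    by apply: vertexlike_conj; [exact: vertexlikeQ|left; eexists].
  have yc : iota y * (S be * c * T be) = S be * c * T be * iota y.
    have := congr1 iota (yC (be ++ ga) A).
    by rewrite !unit_injM monomialE uS_cat uT_cat /c !mulrA.
  clearbody c; have := congr1 (fun u => T be * u * S be) yc.
  rewrite !mulrA uTS -!(mulrA _ (T be) (S be)) uTS.
  rewrite -(mulrA _ c) -Qc mulrA -/z zQ => ->.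
  by rewrite Qc -!mulrA (mulrA (T be)) -/z Qz.
clear yC.
have [d' dd' d'E] : exists2 d', dspan d' & iota d' = Q la * iota d * Q be.
  have [d1 dd1 d1E] := dspan_mulr dd (vertexlikeQ R la).
  have [d2 dd2 d2E] := dspan_mulr dd1 (vertexlikeQ R be).
  exists d2 => //; rewrite d2E d1E; congr (_ * _).
  elim: dd {zE yE d1 dd1 d1E d2 dd2 d2E} => [|a de B x _ IH]; first by rewrite mulr0 mul0r.
  rewrite unit_injD unit_injZ mulrDl mulrDr -scalerAl -scalerAr -IH monomialE.
  congr (_ *: _ + _); apply/esym/vertexlike_conj; first exact: vertexlikeQ.
  by left; eexists.
have zd : z = S la * iota d' by rewrite d'E !mulrA uSQ -zE.
have dz : T la * z = iota d'.
  by rewrite zd mulrA uTS d'E !mulrA uQQ.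
have Qd : Q la * iota d' = iota d' by rewrite d'E !mulrA uQQ.
have dC k : iota d' * cyl (wpow la k) = iota d'.
  elim: k => [|k IH]; first by rewrite /cyl !mulr1.
  rewrite -{1}dz -mulrA (cyl_comm zC) wpowS cyl_cat zd.
  have dc := cyl_comm (fun ga A => dspan_comm ga A dd') (wpow la k).
  have Qc := uQ_cyl_comm la (wpow la k).
  move: (cyl _) IH dc Qc => c IH dc Qc.
  rewrite -!mulrA (mulrA (T la) (S la) (iota d')) uTS Qd (mulrA (T la)) uTS.
  by rewrite mulrA Qc -mulrA Qd -dc.
have [K KP] := dspan_cylinder dd'.
(* [K.+1] turns exceed the bound; two are needed for the word to be a path only
   if [la] is a loop *)
pose k := K.+2; have [|r rE] := KP (wpow la k).
  exact: leq_trans (wpow_size _ la0).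
have dr j : iota d' = r *: cyl (wpow la (k + j)).
  rewrite -[LHS](dC (k + j)%N) wpowD -[X in _ * X = _]cyl_mul_cat mulrA.
  by rewrite [_ * cyl (wpow la k)]rE -scalerAl cyl_mul_cat.
case: (pselect (iota d' = 0)) => [d0|d0].
  by apply: core_z; rewrite y_z zd d0 mulr0 mulr0 mul0r.
have r0 : r <> 0 by move=> r0; apply: d0; rewrite (dr 0%N) r0 scale0r.
have Sk0 : S (wpow la k) <> 0.
  by move=> S0; apply: d0; rewrite (dr 0%N) addn0 /cyl S0 mul0r scaler0.
have uk : upath (wpow la k) by apply: contra_notT Sk0; exact: uS_npath.
case: la la0 zE yE QS d'E zd dz Qd dC rE dr Sk0 uk => // e la _.
move=> zE yE QS d'E zd dz Qd dC rE dr Sk0 uk.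
set l := e :: la in zE yE QS d'E zd dz Qd dC rE dr Sk0 uk *.
have [ul le] : upath l /\ rng (last e la) (src e).
  move: uk; rewrite /k wpowS /upath /l cat_cons /= cat_path => /andP[-> /=].
  by move=> /andP[/set_mem].
have lastk : last e (la ++ wpow l K.+1) = last e la.
  elim: (K.+1) => [|j IH]; first by rewrite cats0.
  by rewrite wpowS last_cat /= last_cat -[in RHS]IH last_cat.
have Qk : Q (wpow l k) = uP R (gset_rng (last e la)).
  have wk : wpow l k = e :: (la ++ wpow l K.+1) by [].
  by rewrite wk /uQ -wk uk lastk.
have Pk : uP R (gset_rng (last e la)) * S (wpow l k) = S (wpow l k).
  by rewrite /k wpowS cat_cons uPS_in.
have Tk : T (wpow l k) * uP R (gset_rng (last e la)) = T (wpow l k).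
  by rewrite /k wpowS cat_cons uTP_in.
set P := uP R (gset_rng (last e la)) in Qk Pk Tk.
have rP : r *: P = r *: cyl (wpow l k).
  have := congr1 (fun u => T (wpow l k) * u * S (wpow l k)) (dr k).
  rewrite (dr 0%N) addn0 wpowD -!scalerAr -!scalerAl cyl_cat_conj Qk.
  have -> : T (wpow l k) * cyl (wpow l k) * S (wpow l k) = P.
    by rewrite -{2}(cats0 (wpow l k)) cyl_cat_conj Qk /cyl !mulr1 uPP.
  have -> : P * cyl (wpow l k) * P = cyl (wpow l k).
    by rewrite /cyl mulrA Pk -mulrA Tk.
  by [].
have dP : iota d' = r *: P by rewrite rP (dr 0%N) addn0.
have lam : loop_without_exits l.
  split; first by split.
  exact: fixed_loop_has_no_exit r0 ul le rP.
have {}yE : y = r *: monomial R (be ++ l) (gset_rng (last e la)) be.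
  apply: unit_inj_inj; rewrite unit_injZ monomialE y_z zd dP uS_cat.
  by rewrite -!scalerAr -scalerAl -/P !mulrA.
rewrite yE; apply: coreZ.
case: (pselect (monomial R (be ++ l) (gset_rng (last e la)) be = 0)) => [->//|].
move=> /monomial_neq0_admissible ad; apply: sub_gen_smallest.
exists (be ++ l), (gset_rng (last e la)), be; split=> //.
by apply: Or32; exists l.
Qed.

(** $y = s_\alpha s_\alpha^* y = y s_\alpha s_\alpha^*$, and the last product
    contains $s_\beta^* s_\alpha = 0$. *)
Lemma incomparable_component y d al be :
    ~~ prefix al be -> ~~ prefix be al ->
    iota y = S al * iota d * T be ->
    (forall ga A, y ** monomial R ga A ga = monomial R ga A ga ** y) ->
  y = 0.
Proof.
move=> nab nba yE yC; apply: unit_inj_inj.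
have yC' ga A : iota y * (S ga * uP R A * T ga) = S ga * uP R A * T ga * iota y.
  by have := congr1 iota (yC ga A); rewrite !unit_injM monomialE.
have cy : cyl al * iota y = iota y.
  by rewrite yE /cyl !mulrA -(mulrA (S al)) uTS uSQ.
rewrite -cy -(cyl_comm yC') yE /cyl -!mulrA (mulrA (T be)) uTS_incomparable //.
by rewrite mul0r !mulr0.
Qed.

Lemma core_stable_involution (st : L -> L) :
    (forall x y, st (x + y) = st x + st y) ->
    (forall (a : R) x, st (a *: x) = a *: st x) ->
    (forall x y, st (x ** y) = st y ** st x) ->
    (forall al A be, st (monomial R al A be) = monomial R be A al) ->
  forall x, core_algebra R G x -> core_algebra R G (st x).
Proof.
move=> stD stZ stM stm; have [c0 cD cZ cM] := core_subalgebra.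
apply: smallest_sub.
  split=> [|x y cx cy|a x cx|x y cx cy] /=.
  - by rewrite -(scale0r (0 : L)) stZ scale0r.
  - by rewrite stD; apply: cD.
  - by rewrite stZ; apply: cZ.
  - by rewrite stM; apply: cM.
move=> _ [al [A [be [[ua ub [v [[va vA] vb]]] h ->]]]] /=; rewrite stm.
apply: sub_gen_smallest; exists be, A, al; split=> //.
  by split=> //; exists v.
by case: h => [->|h|h]; [apply: Or31|apply: Or33|apply: Or32].
Qed.

Lemma spread_involution (st : L -> L) al be y :
    (forall x y, st (x + y) = st x + st y) ->
    (forall (a : R) x, st (a *: x) = a *: st x) ->
    (forall al A be, st (monomial R al A be) = monomial R be A al) ->
  spread al be y -> spread be al (st y).
Proof.
move=> stD stZ stm; elim=> [|a ga A {}y _ IH].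
  by rewrite -(scale0r (0 : L)) stZ scale0r; exact: spread0.
by rewrite stD stZ stm; exact: spread_add.
Qed.

(** The three possible relations between $\alpha$ and $\beta$; the involution
    exchanges the two in which one is a prefix of the other. *)
Lemma spread_commutant al be y : spread al be y ->
    (forall ga A, y ** monomial R ga A ga = monomial R ga A ga ** y) ->
  core_algebra R G y.
Proof.
have extension al' la y' : spread (al' ++ la) al' y' ->
    (forall ga A, y' ** monomial R ga A ga = monomial R ga A ga ** y') ->
    core_algebra R G y'.
  case: (pselect (la = [::])) => [->|la0] sy yC.
    by apply: (@spread_diag_core al'); rewrite -{1}(cats0 al').
  have [d dd] := spread_factor sy; rewrite uS_cat => yE.
  exact: loop_component la0 dd yE yC.
move=> sy yC; case: (boolP (prefix be al)) => [/prefixP[la alE]|nba].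
  by apply: (@extension be la) => //; rewrite -alE.
case: (boolP (prefix al be)) => [/prefixP[la beE]|nab]; last first.
  have [d _ yE] := spread_factor sy.
  rewrite (incomparable_component nab nba yE yC).
  by have [] := core_subalgebra.
have [st [stD stZ stM stm]] := leavitt_involution R G.
have stK : st (st y) = y.
  elim: sy {yC} => [|a ga A {}y _ IH].
    by have := stZ 0 0; rewrite !scale0r => ->; have := stZ 0 0; rewrite !scale0r.
  by rewrite !stD !stZ !stm IH.
rewrite -stK; apply: core_stable_involution => //.
apply: (@extension al la); first by rewrite -beE; exact: spread_involution.
by move=> ga A; have := congr1 st (yC ga A); rewrite !stM stm.
Qed.

Lemma centraliser_sub_core :
  centraliser (diagonal_algebra R G) `<=` core_algebra R G.
Proof.
move=> x xD; have [s xE] := monospanT x.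
have [D sD] := monosum_components s.
have [core0 coreD _ _] := core_subalgebra.
rewrite xE sD; elim/big_ind: _ => // w _.
apply: spread_commutant (component_spread w s) _ => ga A.
apply: component_commute; rewrite -xE; apply: xD.
exact: diagonal_monomial.
Qed.

Lemma centraliser_diagonal :
  centraliser (diagonal_algebra R G) = core_algebra R G.
Proof.
by apply/seteqP; split; [exact: centraliser_sub_core|exact: core_sub_centraliser].
Qed.

(** A commutative algebra containing the core contains the diagonal, so it
    centralises the diagonal. *)
Lemma core_maximal_commutative :
  maximal_commutative_subalgebra (core_algebra R G).
Proof.
split; [exact: gen_subalgebraP|exact: core_commutative|].
move=> C sC cC MC; apply/seteqP; split=> // x Cx.
apply: centraliser_sub_core => y Dy; apply: cC => //.
by apply: MC; exact: diagonal_sub_core.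
Qed.

End CentraliserOfDiagonal.

(** * Connected ultragraphs whose core is central *)

Section AlgebraAsNonUnital.
Variables (R : comNzRingType) (B : algType R).

Definition nu_alg : Type := B.

HB.instance Definition _ := GRing.Lmodule.copy nu_alg B.

Definition nu_alg_mul (x y : nu_alg) : nu_alg := (x : B) * (y : B).

Fact nu_alg_mulA : associative nu_alg_mul.
Proof. exact: mulrA. Qed.
Fact nu_alg_mulDl : left_distributive nu_alg_mul +%R.
Proof. exact: mulrDl. Qed.
Fact nu_alg_mulDr : right_distributive nu_alg_mul +%R.
Proof. exact: mulrDr. Qed.
Fact nu_alg_scaleAl (a : R) x y : a *: nu_alg_mul x y = nu_alg_mul (a *: x) y.
Proof. exact: scalerAl. Qed.
Fact nu_alg_scaleAr (a : R) x y : a *: nu_alg_mul x y = nu_alg_mul x (a *: y).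
Proof. exact: scalerAr. Qed.

HB.instance Definition _ := Lmodule_isNonUnitalAlgebra.Build R nu_alg
  nu_alg_mulA nu_alg_mulDl nu_alg_mulDr nu_alg_scaleAl nu_alg_scaleAr.

Lemma isomorphic_algebraI (A : nuAlgType R) (f : A -> nu_alg) :
  nu_hom f -> bijective f -> isomorphic_algebra A B.
Proof.
move=> [fD fZ fM] fbij.
have flin : linear (f : A -> B) by move=> a x y; rewrite -fZ -fD.
pose fL := HB.pack_for {linear A -> B} (f : A -> B)
  (GRing.isLinear.Build R A B *:%R (f : A -> B) flin).
by exists fL; split=> // x y; exact: fM.
Qed.

End AlgebraAsNonUnital.

Section CentralCore.
Variables (R : comNzRingType) (G : ultragraph).
Local Notation L := (leavitt R G).
Local Notation p v := (uP R (gset1 v)).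
Hypothesis DZ : diagonal_algebra R G `<=` nu_center L.

Lemma diagonal_central ga A (x : L) :
  monomial R ga A ga ** x = x ** monomial R ga A ga.
Proof. by apply: DZ => //; exact: diagonal_monomial. Qed.

Lemma p_neq0 (v : vertex G) : p v <> 0.
Proof.
move=> pv; have := @scale_lP1_eq0 R G 1 v; rewrite scale1r => h.
by have /eqP := h (unit_inj_inj pv); rewrite oner_eq0.
Qed.

(** Centrality of $p_{s(e)}$ gives $s_e = s_e p_{s(e)}$, hence
    $p_{r(e)} = p_{r(e)} p_{s(e)}$. *)
Lemma central_rng (e : edge G) : rng e = [set src e].
Proof.
have := congr1 (@unit_inj R L) (diagonal_central [::] (gset1 (src e)) (lS R e)).
rewrite !unit_injM !monomialE !mul1r !mulr1 -/(us R e) uP_src => se.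
have into w : rng e w -> w = src e.
  move=> ew; apply: contrapT => we; apply: (@p_neq0 w).
  have := congr1 (fun u => p w * (ut R e * u)) se.
  rewrite !mulrA -!(mulrA (p w) (ut R e)) ut_us eqxx.
  have -> : p w * uP R (gset_rng e) = p w by rewrite uPC uPI gsetI_in.
  by move=> ->; rewrite uPC uPI gsetI_out ?uP0 // => /esym.
apply/seteqP; split=> [w /into //|_ ->].
by have [w ew] := rng_neq0 e; rewrite -(into w ew).
Qed.

(** All ranges being equal to the corresponding sources, no path leaves its
    initial vertex. *)
Lemma connected_single_vertex : ultragraph_connected G ->
  forall v w : vertex G, v = w.
Proof.
have last_src (e : edge G) al : upath (e :: al) -> src (last e al) = src e.
  elim: al e => [|f al IH] e //; rewrite upath_cons2 => /andP[/set_mem fe ual].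
  by rewrite [LHS]IH //; move: fe; rewrite central_rng.
move=> conn v w; have [//|[e [al [ue <-]]]] := conn v w.
by rewrite /= central_rng last_src.
Qed.

(** Centrality of $s_e s_e^*$ makes $s_e$ invertible in the corner at its
    source; another edge there would have range projection $0$. *)
Lemma central_single_edge : (forall v w : vertex G, v = w) ->
  forall e : edge G, us R e * ut R e = p (src e) /\ forall f, f = e.
Proof.
move=> single e.
have Pr : uP R (gset_rng e) = p (src e).
  by congr uP; apply: gset_inj; rewrite /= central_rng.
have := congr1 (@unit_inj R L) (diagonal_central [:: e] (gset_rng e) (lS R e)).
rewrite !unit_injM -!/(uP _ _) -!/(us _ _) -!/(ut _ _) uP_rng.
rewrite -mulrA ut_us eqxx us_rng => se.
have st : us R e * ut R e = p (src e).
  have := congr1 (fun u => ut R e * u) se.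
  by rewrite !mulrA ut_us eqxx Pr uP_src.
split=> // f; apply: contrapT => /eqP/negbTE fe; apply: (@p_neq0 (src f)).
have Prf : uP R (gset_rng f) = p (src f).
  by congr uP; apply: gset_inj; rewrite /= central_rng.
rewrite -Prf; have := congr1 (fun u => ut R f * u * us R f) st.
rewrite !mulrA ut_us fe !mul0r (single (src e) (src f)) ut_src ut_us eqxx.
by [].
Qed.

End CentralCore.

Section OneVertex.
Variables (R : comNzRingType) (G : ultragraph).
Local Notation L := (leavitt R G).
Variable v : vertex G.
Hypothesis vP : forall w : vertex G, w = v.

Lemma gset_one (A : gset G) :
  (A = gset0 G /\ ~ sval A v) \/ (A = gset1 v /\ sval A v).
Proof.
case: (pselect (sval A v)) => Av; [right|left]; split=> //; apply: gset_inj.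
  by apply/seteqP; split=> w //= _; rewrite (vP w).
by apply/seteqP; split=> w //=; rewrite (vP w).
Qed.

Lemma one_vertex_unit (x : L) : x ** lP R (gset1 v) = x.
Proof.
have [A <-] := right_local_unit x; rewrite -nmulA; congr (_ ** _).
apply: unit_inj_inj; rewrite unit_injM -!/(uP _ _) uPI; congr uP.
by apply: gset_inj; apply/setIidPl => w _; exact: vP.
Qed.

(** With a single vertex, $\mathcal G^0$ consists of the empty set and the
    whole vertex set; $p_A$ is to be sent to $0$ and $1$ respectively. *)
Definition one_if (B : algType R) (A : gset G) : nu_alg B :=
  if `[< sval A v >] then (1 : B) else 0.

Lemma one_if_P (B : algType R) :
  [/\ one_if B (gset0 G) = 0,
      forall A A', one_if B A ** one_if B A' = one_if B (gsetI A A') &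
      forall A A', one_if B (gsetU A A')
                   = one_if B A + one_if B A' - one_if B (gsetI A A')].
Proof.
rewrite /one_if; split=> [|A A'|A A'] /=; first by case: asboolP.
  rewrite asbool_and; case: asboolP => _; case: asboolP => _ /=;
    rewrite ?nmul0l ?nmul0r //; exact: mul1r.
rewrite asbool_and asbool_or.
by case: asboolP => _; case: asboolP => _ /=; rewrite ?subr0 ?addr0 ?add0r ?addrK.
Qed.

Lemma one_vertex_no_edge : no_edges G -> isomorphic_algebra L R^o.
Proof.
move=> noe; have [p0 pI pU] := one_if_P R^o.
have [|f [[fh fP _ _] _]] := @leavitt_universal R G (nu_alg R^o)
    (one_if R^o) (fun=> 0) (fun=> 0).
  split; [by []|by move=> e; case: (noe e)|by move=> e; case: (noe e)|].
  by move=> w [//|e es]; case: (noe e).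
apply: (isomorphic_algebraI fh); have [fD fZ fM] := fh.
have f1 : f (lP R (gset1 v)) = (1 : R^o).
  by rewrite fP /one_if; case: asboolP => // -[].
have f0 : f 0 = 0 by apply: (addrI (f 0)); rewrite -fD !addr0.
exists (fun r : R^o => (r : R) *: lP R (gset1 v)) => [x|r]; last first.
  by rewrite fZ f1; exact: mulr1.
rewrite -[RHS]one_vertex_unit.
elim/tclass_ind: x => t.
set tc := @tclass R _ (@leavitt_rel R G).
suff H (y : L) : (f y : R) *: lP R (gset1 v) = y ->
    (f (tc t ** y) : R) *: lP R (gset1 v) = tc t ** y.
  have := H (lP R (gset1 v)); rewrite f1 scale1r one_vertex_unit; exact.
elim: t y => [[A|e|e]||t IHt u IHu|a t IH|t IHt u IHu] y yE;
    try by case: (noe e).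
- rewrite -[tc (TGen _)]/(lP R A) -{2}yE fM fP /one_if.
  case: (gset_one A) => -[-> Av]; case: asboolP => // _.
    by rewrite nmul0l scale0r; case: (leavittP R G) => -[-> _ _] _ _ _; rewrite nmul0l.
  have -> : nmul ((1 : R^o) : nu_alg R^o) (f y) = f y by exact: mul1r.
  by rewrite -nscaleAr one_vertex_unit.
- by rewrite [tc _]tclass0 nmul0l f0 scale0r.
- by rewrite [tc _]tclassD nmulDl fD scalerDl IHt // IHu.
- by rewrite [tc _]tclassZ -nscaleAl fZ -{2}(IH y yE) scalerA.
- by rewrite [tc _]tclassM -nmulA; apply/IHt/IHu.
Qed.

Section OneEdge.
Variable e : edge G.
Hypothesis eP : forall f : edge G, f = e.
Hypothesis stE : us R e * ut R e = uP R (gset1 v).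

Local Notation one := (lP R (gset1 v)).
Local Notation s := (lS R e).
Local Notation t := (lSs R e).

Lemma one_edge_rng : rng e = [set v].
Proof.
have [w ew] := rng_neq0 e; apply/seteqP; split=> [u _|_ ->]; first exact: vP.
by rewrite -(vP w).
Qed.

Lemma one_edge_st : s ** t = one.
Proof. by apply: unit_inj_inj; rewrite unit_injM. Qed.

Lemma one_edge_ts : t ** s = one.
Proof.
apply: unit_inj_inj; rewrite unit_injM -/(ut R e) -/(us R e) ut_us eqxx.
by congr uP; apply: gset_inj; rewrite /= one_edge_rng.
Qed.

Lemma one_edge_unit_s : one ** s = s.
Proof.
by apply: unit_inj_inj; rewrite unit_injM -(vP (src e)); exact: uP_src.
Qed.

Lemma one_edge_unit_t : one ** t = t.
Proof. by rewrite -one_edge_ts -nmulA one_edge_st one_vertex_unit. Qed.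

Fixpoint lpow (x : L) n : L := if n is m.+1 then x ** lpow x m else one.

Lemma one_lpow_s n : one ** lpow s n = lpow s n.
Proof. by case: n => [|n] /=; rewrite ?one_vertex_unit // nmulA one_edge_unit_s. Qed.

Lemma one_lpow_t n : one ** lpow t n = lpow t n.
Proof. by case: n => [|n] /=; rewrite ?one_vertex_unit // nmulA one_edge_unit_t. Qed.

(** The integer powers of $s_e$, with $s_e^*$ in the role of the inverse *)
Definition zpow (i : int) : L :=
  match i with Posz n => lpow s n | Negz n => lpow t n.+1 end.

Lemma s_zpow i : exists j, s ** zpow i = zpow j.
Proof.
case: i => [n|[|n]]; first by exists n.+1.
  by exists 0; rewrite /= one_vertex_unit one_edge_st.
by exists (Negz n); rewrite /= nmulA one_edge_st; exact: (one_lpow_t n.+1).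
Qed.

Lemma t_zpow i : exists j, t ** zpow i = zpow j.
Proof.
case: i => [[|n]|n]; first by exists (Negz 0).
  by exists n; rewrite /= nmulA one_edge_ts one_lpow_s.
by exists (Negz n.+1).
Qed.

Lemma one_zpow i : one ** zpow i = zpow i.
Proof. by case: i => n; [exact: one_lpow_s|exact: one_lpow_t]. Qed.

Definition of_laurent (F : laurent R) : L := \sum_(i <- msupp F) F@_i *: zpow i.

Lemma of_laurentw (d : {fset int}) (F : laurent R) : (msupp F `<=` d)%fset ->
  of_laurent F = \sum_(i <- d) F@_i *: zpow i.
Proof.
move=> le; rewrite /of_laurent (big_fset_incl _ le) //= => i _ /mcoeff_outdom->.
by rewrite scale0r.
Qed.

Lemma of_laurentD F F' : of_laurent (F + F') = of_laurent F + of_laurent F'.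
Proof.
pose d := (msupp F `|` msupp F')%fset.
rewrite (@of_laurentw d (F + F')) ?msuppD_le //.
rewrite (@of_laurentw d F) ?fsubsetUl // (@of_laurentw d F') ?fsubsetUr //.
by rewrite -big_split; apply: eq_bigr => i _; rewrite mcoeffD scalerDl.
Qed.

Lemma of_laurentU (a : R) i : of_laurent << a *g i >> = a *: zpow i.
Proof.
rewrite (@of_laurentw [fset i]%fset) ?msuppU_le //.
by rewrite big_seq_fset1 mcoeffUU.
Qed.

Lemma of_laurentZ (a : R) F : of_laurent (a *: F) = a *: of_laurent F.
Proof.
elim/laurent_ind: F => [|F F' IH IH'|b i].
- by rewrite scaler0 /of_laurent msupp0 big_seq_fset0 scaler0.
- by rewrite scalerDr !of_laurentD IH IH' scalerDr.
- by rewrite laurent_scaleU !of_laurentU scalerA.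
Qed.

Local Notation X i := (<< (1 : R) *g (i : int) >> : laurent R).

Lemma laurent_mulX i j : X i * X j = X (i + j).
Proof. by rewrite [LHS]laurent_mulU mulr1. Qed.

(** The homomorphism $s_e \mapsto x$, $s_e^* \mapsto x^{-1}$ has the linear
    right inverse [of_laurent]; the image of the latter is everything because it
    is stable under left multiplication by the generators. *)
Lemma one_vertex_one_edge : isomorphic_algebra L (laurent R).
Proof.
have [p0 pI pU] := one_if_P (laurent R).
have ifv A : sval A v -> one_if (laurent R) A = (1 : laurent R).
  by rewrite /one_if; case: asboolP.
have [|f [[fh fP fS fSs] _]] := @leavitt_universal R G (nu_alg (laurent R))
    (one_if (laurent R)) (fun=> X 1) (fun=> X (- 1)).
  split=> //.
  - move=> f; rewrite !ifv /= ?(eP f) ?one_edge_rng ?(vP (src e)) //.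
    by split; [exact: mul1r|exact: mulr1|exact: mul1r|exact: mulr1].
  - move=> f f'; rewrite (eP f) (eP f') eqxx ifv /= ?one_edge_rng //.
    by rewrite [LHS]laurent_mulX addNr.
  - move=> w es es0 ues esv; rewrite ifv /=; last by rewrite (vP w).
    have -> : es = [:: e].
      case: es es0 ues esv => // a [|b es] _ //= ; first by rewrite (eP a).
      by rewrite (eP a) (eP b) inE eqxx.
    by rewrite big_seq1 [RHS]laurent_mulX subrr.
apply: (isomorphic_algebraI fh); have [fD fZ fM] := fh.
have f0 : f 0 = 0 by apply: (addrI (f 0)); rewrite -fD !addr0.
have fz i : f (zpow i) = X i.
  case: i => n /=; elim: n => [|n IH] /=.
  - by rewrite fP ifv.
  - by rewrite fM IH fS [LHS]laurent_mulX -intS.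
  - by rewrite fM fSs fP ifv //; exact: mulr1.
  - by rewrite fM IH fSs [LHS]laurent_mulX !NegzE [in RHS]intS opprD.
have fK F : f (of_laurent F) = F.
  elim/laurent_ind: F => [|F F' IH IH'|a i].
  - by rewrite /of_laurent msupp0 big_seq_fset0 f0.
  - by rewrite of_laurentD fD IH IH'.
  - by rewrite of_laurentU fZ fz [LHS]laurent_scaleU mulr1.
exists of_laurent => // x.
pose W (y : L) := of_laurent (f y) = y.
have W0 : W 0 by rewrite /W f0 /of_laurent msupp0 big_seq_fset0.
have WD y z : W y -> W z -> W (y + z) by rewrite /W fD of_laurentD => -> ->.
have WZ a y : W y -> W (a *: y) by rewrite /W fZ of_laurentZ => ->.
have Wz i : W (zpow i) by rewrite /W fz of_laurentU scale1r.
have Wmul (y : L) : (forall i, W (y ** zpow i)) -> forall z, W z -> W (y ** z).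
  move=> yz z <-; rewrite /of_laurent nmul_sumr; elim/big_ind: _ => // i _.
  by rewrite -nscaleAr; apply/WZ/yz.
rewrite -/(W x) -[x]one_vertex_unit.
have W1 : W one := Wz 0.
elim/tclass_ind: x one W1 => u; elim: u => [g||u IHu u' IHu'|a u IH|u IHu u' IHu'] y yW.
- apply: Wmul => // i; case: g => [A|f'|f'].
  + rewrite -/(lP R A); case: (gset_one A) => -[-> _].
      by case: (leavittP R G) => -[-> _ _] _ _ _; rewrite nmul0l.
    by rewrite one_zpow.
  + by rewrite -/(lS R f') (eP f'); have [j ->] := s_zpow i.
  + by rewrite -/(lSs R f') (eP f'); have [j ->] := t_zpow i.
- by rewrite tclass0 nmul0l.
- by rewrite tclassD nmulDl; apply: WD; [exact: IHu|exact: IHu'].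
- by rewrite tclassZ -nscaleAl; apply/WZ/IH.
- by rewrite tclassM -nmulA; apply/IHu/IHu'.
Qed.

End OneEdge.

End OneVertex.

Lemma central_core_connected (R : comNzRingType) (G : ultragraph) :
    diagonal_algebra R G `<=` nu_center (leavitt R G) ->
    ultragraph_connected G ->
  [/\ single_vertex G, no_edges G & isomorphic_algebra (leavitt R G) R^o] \/
  [/\ single_vertex G, single_edge G &
      isomorphic_algebra (leavitt R G) (laurent R)].
Proof.
move=> DZ conn; have single := connected_single_vertex DZ conn.
case: (pselect (exists e : edge G, True)) => [[e _]|noe].
  right; have [st eP] := central_single_edge DZ single e.
  split; [by exists (src e)|by exists e|].
  apply: (@one_vertex_one_edge R G (src e) (fun w => single w (src e)) e eP).
  exact: st.
left; have [v] := vertex_inhabited G.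
have ne : no_edges G by move=> e; apply: noe; exists e.
by split=> //; [exists v|exact: one_vertex_no_edge (fun w => single w v) ne].
Qed.

Theorem corollary6p14 (R : comNzRingType) (G : ultragraph) :
  [/\ centraliser (diagonal_algebra R G) = core_algebra R G,
      maximal_commutative_subalgebra (core_algebra R G) &
      nu_center (leavitt R G) = core_algebra R G -> ultragraph_connected G ->
        [/\ single_vertex G, no_edges G &
            isomorphic_algebra (leavitt R G) R^o] \/
        [/\ single_vertex G, single_edge G &
            isomorphic_algebra (leavitt R G) (laurent R)]].
Proof.
split; [exact: centraliser_diagonal|exact: core_maximal_commutative|].
move=> ZM; apply: central_core_connected; rewrite ZM.
exact: diagonal_sub_core.
Qed.
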